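(* Let $N\ge 3$ and for $1\le k<N/2$ let $t_k=\tan(\pi/N)/\tan(k\pi/N)$. Then the set $T=\{t_k: 1\le k<N/2,\ \gcd(k,N)=1\}$ is linearly independent over $\mathbb{Q}$, and every $t_j$ with $1\le j<N/2$ is a $\mathbb{Q}$-linear combination of elements of $T$. In particular the $\mathbb{Q}$-span of all the $t_k$ has dimension $|T|=\varphi(N)/2$.
   Context: The $t_k$ are the scales of the regular $N$-gon; those with $\gcd(k,N)=1$ are the primitive scales. $\varphi$ is Euler's totient function. *)

(* Defs.v *)
From HB Require Import structures.
From mathcomp Require Import all_boot all_order all_algebra.
From mathcomp Require Import reals trigo.
Set Implicit Arguments. Unset Strict Implicit. Unset Printing Implicit Defensive.
Import Order.TTheory GRing.Theory Num.Theory.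
Local Open Scope ring_scope.

Definition scale (R : realType) (N k : nat) : R :=
  tan (pi / N%:R) / tan (k%:R * pi / N%:R).

Definition prim_index (N : nat) (k : nat) : bool :=
  [&& (0 < k)%N, (k.*2 < N)%N & coprime k N].

(* Main.v *)
Require Import Defs.
From HB Require Import structures.
From mathcomp Require Import all_boot all_order all_algebra all_field.
From mathcomp Require Import classical_sets reals topology normedtype sequences.
From mathcomp Require Import derive realfun exp trigo.
From mathcomp Require Import complex.
From mathcomp Require Import ring lra zify.
Import Order.TTheory GRing.Theory Num.Theory.
Import numFieldNormedType.Exports.
Local Open Scope ring_scope.
Set Implicit Arguments. Unset Strict Implicit. Unset Printing Implicit Defensive.

(* Up to the factor tan(pi/N) the scales are the cotangents cot(k pi/N), and
   - i cot(k pi/N) lies in Q(zeta_N).  A rational relation between the primitive ones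
   extends to an odd function c on (Z/N)^*, and Galois conjugation makes every twist of c
   a relation too.  The partial fraction expansion of the cotangent turns this into
   sum_n c(bn)/n = 0 for all b coprime to N, so independence is the nonvanishing of
   L(1, chi) for odd chi.  That nonvanishing is proved without characters: for the
   autocorrelation e of c, Selberg's identity gives sum_{n <= x} e(n) Lambda(n)/n =
   - ln x + O(1), so almost all of the mass of Lambda(n)/n sits on {e = -1}.  If e^2 is
   not constantly 1 on (Z/N)^*, then e^2 minus its mean, which is invariant under
   {e = -1}, contradicts the same estimate; otherwise e is a real character and Monsky's
   argument applies.  For the span, the phi(N)/2 independent imaginary numbers
   - i cot(k pi/N) and their real multiples by - i cot(pi/N) form a basis of Q(zeta_N). *)

(** * Abel summation and the series sum f(n)/n *)

(** Characters would bring in complex values and the duality of the unit group; the autocorrelation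
    e of c avoids both. It is real, e(1) = 1, |e| <= 1, and every series of e(dn)/n inherits sum 0
    from the twists of c. That the mass sits on {e = -1} is not yet absurd. The lever is the
    equality case of Cauchy-Schwarz: where e(n) = -1, multiplication by n changes the sign of c,
    hence of e, and leaves e^2 alone. A function f of mean zero invariant under such n again has
    series with sum 0, because ln is the divisor sum of Lambda and nearly all weight falls on those
    n. Selberg's identity then gives the sum of f(n) Lambda(n)/n as - f(1) ln x + O(1), while
    concentration gives + f(1) ln x + O(1), so f(1) <= 0. For e^2 minus its mean the value at 1 is
    positive, unless e^2 = 1 on all units. *)

Section AbelSummation.
Variable R : realFieldType.
Implicit Types f g : nat -> R.

(** Summation by parts writes the sum as a combination of partial sums of [f] with the nonnegative
    weights [g n - g n.+1] and [g k], which add up to [g m]. *)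
Lemma abel_summation f g (B : R) m k :
  (forall n, (m <= n)%N -> `|\sum_(m <= i < n) f i| <= B) ->
  (forall n, (m <= n)%N -> 0 <= g n) ->
  (forall n, (m <= n)%N -> g n.+1 <= g n) ->
  `|\sum_(m <= n < k) f n * g n| <= B * g m.
Proof.
move=> fB g0 gmono.
have B0 : 0 <= B by apply: le_trans (fB m _).
have [km|/ltnW mk] := leqP k m.
  by rewrite big_geq // normr0 mulr_ge0 // g0.
pose F n := \sum_(m <= i < n) f i.
have parts : \sum_(m <= n < k) f n * g n =
    F k * g k + \sum_(m <= n < k) F n.+1 * (g n - g n.+1).
  elim: k mk => [|k IH]; first by rewrite leqn0 => /eqP->; rewrite /F !big_geq // mul0r add0r.
  rewrite leq_eqVlt => /predU1P[<-|]; first by rewrite /F !big_geq // mul0r add0r.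
  rewrite ltnS => mk; rewrite !big_nat_recr //= (IH mk).
  have -> : F k.+1 = F k + f k by rewrite /F big_nat_recr.
  ring.
rewrite parts; apply: le_trans (ler_normD _ _) _.
have -> : B * g m = B * g k + \sum_(m <= n < k) B * (g n - g n.+1).
  rewrite -big_distrr /= -mulrDr; congr (_ * _).
  have E2 : \sum_(m <= n < k) (g n - g n.+1) = g m - g k.
    rewrite -[LHS]opprK -sumrN; under eq_bigr do rewrite opprB.
    by rewrite telescope_sumr // opprB.
  by rewrite E2; ring.
apply: lerD; first by rewrite normrM (ger0_norm (g0 _ mk)); apply: ler_wpM2r; [exact: g0|exact: fB].
apply: le_trans (ler_norm_sum _ _ _) _.
rewrite big_nat_cond [leRHS]big_nat_cond; apply: ler_sum => n.
rewrite andbT => /andP[mn nk].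
rewrite normrM (@ger0_norm _ (g n - _)) ?subr_ge0 ?gmono //; apply: ler_wpM2r; first by rewrite subr_ge0 gmono.
by apply: fB; rewrite leqW.
Qed.

Definition per (N : nat) f := forall n, f (n + N)%N = f n.

Lemma per_modn N f n : per N f -> f (n %% N)%N = f n.
Proof.
move=> pf; rewrite [in RHS](divn_eq n N); elim: (n %/ N)%N => [|q IH].
  by rewrite mul0n.
by rewrite mulSn -addnA addnC pf.
Qed.

Lemma per_sum_bound N f : (0 < N)%N -> per N f -> \sum_(0 <= n < N) f n = 0 ->
  exists2 B : R, 0 <= B & forall m k, (m <= k)%N -> `|\sum_(m <= n < k) f n| <= B.
Proof.
move=> N0 pf f0; pose F k := \sum_(0 <= n < k) f n.
have perF : per N F.
  move=> k; rewrite /F addnC (@big_cat_nat _ _ _ N) ?leq_addr //= f0 add0r.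
  rewrite -{1}[N]add0n big_addn addKn; apply: eq_bigr => i _; exact: pf.
pose B := \sum_(0 <= n < N) `|f n|.
have FB k : `|F k| <= B.
  rewrite -(per_modn k perF) /F; have /ltnW kN := ltn_pmod k N0.
  apply: le_trans (ler_norm_sum _ _ _) _.
  by rewrite /B [leRHS](@big_cat_nat _ _ _ (k %% N)%N) //= lerDl sumr_ge0.
exists (B + B); first by rewrite addr_ge0 // sumr_ge0.
move=> m k mk; have -> : \sum_(m <= n < k) f n = F k - F m.
  by rewrite /F (@big_cat_nat _ _ _ m 0 k) //= addrAC subrr add0r.
by apply: le_trans (ler_normB _ _) _; rewrite lerD.
Qed.

Definition hsum f x : R := \sum_(1 <= m < x.+1) f m / m%:R.

Lemma hsum_tail N f : (0 < N)%N -> per N f -> \sum_(0 <= n < N) f n = 0 ->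
  exists2 B : R, 0 <= B &
    forall x y, (x <= y)%N -> `|hsum f y - hsum f x| <= B / x.+1%:R.
Proof.
move=> N0 pf f0; have [B B0 HB] := per_sum_bound N0 pf f0.
exists B => // x y xy.
have -> : hsum f y - hsum f x = \sum_(x.+1 <= m < y.+1) f m * m%:R^-1.
  by rewrite /hsum (@big_cat_nat _ _ _ x.+1 1 y.+1) //= addrAC subrr add0r.
apply: (@abel_summation _ (fun m => m%:R^-1)) => n xn; first exact: HB.
  by rewrite invr_ge0.
have n0 : (0 < n)%N by apply: leq_ltn_trans xn.
by rewrite lef_pV2 ?posrE ?ltr0n // ler_nat.
Qed.

Lemma hsum_bounded N f : (0 < N)%N -> per N f -> \sum_(0 <= n < N) f n = 0 ->
  exists2 B : R, 0 <= B & forall x, `|hsum f x| <= B.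
Proof.
move=> N0 pf f0; have [B B0 HB] := hsum_tail N0 pf f0.
exists B => // x; have := HB 0%N x isT.
by rewrite /hsum [X in _ - X]big_geq // subr0 divr1.
Qed.

(** Encodes that the series of f(n)/n has sum 0. The rate O(1/x) comes free for periodic [f] of mean
    zero and is what [selberg_asymptotic] consumes. *)
Definition vanishing f :=
  exists2 C : R, 0 <= C & forall x, `|hsum f x| <= C / x.+1%:R.

(** By [hsum_tail] all later partial sums stay within B/(x+1) of [hsum f x], so arbitrarily small
    values arbitrarily far out force [hsum f x] itself below B/(x+1). *)
Lemma vanishing_subseq N f : (0 < N)%N -> per N f -> \sum_(0 <= n < N) f n = 0 ->
  (forall (e : R) X, 0 < e -> exists2 y, (X <= y)%N & `|hsum f y| <= e) ->
  vanishing f.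
Proof.
move=> N0 pf f0 H; have [B B0 HB] := hsum_tail N0 pf f0.
exists B => // x; apply/ler_addgt0Pr => e e0.
have [y xy Hy] := H e x e0.
have -> : hsum f x = hsum f y - (hsum f y - hsum f x) by rewrite opprB addrC subrK.
by apply: le_trans (ler_normB _ _) _; rewrite addrC lerD // HB.
Qed.

End AbelSummation.

(** * Divisor sums, the Moebius and von Mangoldt functions *)

Section DivisorSums.
Variable V : nmodType.

Definition dsum (F : nat -> V) n : V := \sum_(1 <= d < n.+1 | (d %| n)%N) F d.

Lemma dsum_widen (F : nat -> V) n x : (0 < n <= x)%N ->
  dsum F n = \sum_(1 <= d < x.+1 | (d %| n)%N) F d.
Proof.
case/andP=> n0 nx.
rewrite [in RHS](@big_cat_nat _ _ _ n.+1) //= [X in _ = _ + X]big1_seq ?addr0 //.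
move=> d /andP[dn]; rewrite mem_index_iota => /andP[nd _].
by have := dvdn_leq n0 dn; rewrite leqNgt nd.
Qed.

Lemma dsum1 (F : nat -> V) : dsum F 1 = F 1%N.
Proof. by rewrite /dsum big_mkcond big_nat1. Qed.

Lemma sum_multiples (G : nat -> V) d x : (0 < d)%N ->
  \sum_(1 <= n < x.+1 | (d %| n)%N) G n =
  \sum_(1 <= m < (x %/ d).+1) G (d * m)%N.
Proof.
move=> d0; elim: x => [|x IH]; first by rewrite div0n !big_geq.
rewrite big_mkcond big_nat_recr //= -big_mkcond /= IH divnS //.
have [dx|_] := boolP (d %| x.+1)%N; last by rewrite add0n addr0.
rewrite add1n [in RHS]big_nat_recr //=; congr (_ + G _).
by move: (divnS x d0); rewrite dx add1n => <-; rewrite mulnC divnK.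
Qed.

(** Both sides run over the pairs d, m with d m <= x. *)
Lemma sum_dsum (F : nat -> nat -> V) x :
  \sum_(1 <= n < x.+1) dsum (fun d => F d (n %/ d)%N) n =
  \sum_(1 <= d < x.+1) \sum_(1 <= m < (x %/ d).+1) F d m.
Proof.
transitivity (\sum_(1 <= n < x.+1) \sum_(1 <= d < x.+1 | (d %| n)%N) F d (n %/ d)%N).
  by apply: eq_big_nat => n /andP[n0 nx]; rewrite (@dsum_widen _ n x) ?n0.
rewrite (exchange_big_dep predT) //=; apply: eq_big_nat => d /andP[d0 dx].
by rewrite sum_multiples //; apply: eq_bigr => m _; rewrite mulKn.
Qed.

(** Both sides run over the pairs d, k whose product divides n. *)
Lemma dsum_assoc (G : nat -> nat -> V) n : (0 < n)%N ->
  dsum (fun d => dsum (G d) (n %/ d)) n =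
  dsum (fun k => dsum (G ^~ k) (n %/ k)) n.
Proof.
move=> n0.
have H (F : nat -> nat -> V) : dsum (fun d => dsum (F d) (n %/ d)) n =
    \sum_(1 <= d < n.+1) \sum_(1 <= k < n.+1) if (d * k %| n)%N then F d k else 0.
  rewrite /dsum big_mkcond; apply: eq_big_nat => d /andP[d0 dn].
  have [ddn|nddn] := boolP (d %| n)%N; last first.
    rewrite big1 // => k _; case: ifP => // /(dvdn_trans (dvdn_mulr k (dvdnn d))).
    by rewrite (negbTE nddn).
  rewrite -/(dsum _ _) (@dsum_widen _ _ n) ?divn_gt0 ?dn ?leq_div ?andbT // big_mkcond.
  by apply: eq_bigr => k _; rewrite dvdn_divRL // mulnC.
rewrite !H exchange_big /=.
by apply: eq_bigr => k _; apply: eq_bigr => d _; rewrite mulnC.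
Qed.

(** A divisor of n prime to p already divides n / p, and the others are p times the divisors of n /
    p. Serves both the Moebius cancellation and the recursion over prime powers for characters. *)
Lemma dsum_split_prime (F : nat -> V) p n : prime p -> (0 < n)%N -> (p %| n)%N ->
  dsum F n = \sum_(1 <= d < n.+1 | (d %| n %/ p)%N && ~~ (p %| d)%N) F d
             + dsum (fun d => F (p * d)%N) (n %/ p).
Proof.
move=> pp n0 pn; have p0 := prime_gt0 pp.
rewrite /dsum (bigID (dvdn p)) /= addrC; congr (_ + _).
  apply: eq_bigl => d; apply: andb_id2r => pd.
  rewrite -{1}(divnK pn) Gauss_dvdl // coprime_sym prime_coprime //.
rewrite [LHS](_ : _ = \sum_(1 <= d < n.+1 | (p %| d)%N) if (d %| n)%N then F d else 0).
  rewrite sum_multiples // [RHS]big_mkcond; apply: eq_bigr => d _.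
  by rewrite dvdn_divRL // mulnC.
rewrite big_mkcond [RHS]big_mkcond; apply: eq_bigr => d _.
by case: (d %| n)%N; case: (p %| d)%N.
Qed.

End DivisorSums.

Section Moebius.
Variable R : realType.

Definition moebius n : R := \prod_(p <- primes n) (if logn p n == 1%N then -1 else 0).

Lemma moebius1 : moebius 1 = 1.
Proof. by rewrite /moebius big_nil. Qed.

Lemma norm_moebius n : `|moebius n| <= 1.
Proof.
rewrite /moebius; elim/big_ind: _ => [|x y x1 y1|p _]; first by rewrite normr1.
  by rewrite normrM mulr_ile1.
by case: ifP => _; rewrite ?normrN1 ?normr0.
Qed.

Lemma moebius_prime_mul p d : prime p -> (0 < d)%N ->
  moebius (p * d) = if (p %| d)%N then 0 else - moebius d.
Proof.
move=> pp d0; have p0 := prime_gt0 pp; have pd0 : (0 < p * d)%N by rewrite muln_gt0 p0.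
case: ifP => pd.
  have pin : p \in primes (p * d) by rewrite mem_primes pp pd0 dvdn_mulr.
  rewrite /moebius (big_rem p) //= lognM // logn_prime // eqxx add1n.
  by rewrite eqSS -leqn0 leqNgt logn_gt0 mem_primes pp d0 pd /= mul0r.
have E : perm_eq (primes (p * d)) (p :: primes d).
  apply: uniq_perm; rewrite ?primes_uniq //=; first by rewrite mem_primes pd !andbF primes_uniq.
  by move=> q; rewrite primesM // in_cons primes_prime // mem_seq1.
rewrite /moebius (perm_big _ E) big_cons lognM // logn_prime // eqxx add1n.
have -> : logn p d = 0%N by apply/eqP; rewrite -leqn0 leqNgt logn_gt0 mem_primes pd !andbF.
rewrite eqxx /= mulN1r; congr (- _); rewrite !big_seq; apply: eq_bigr => q qd.
rewrite lognM // logn_prime //.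
have /negbTE-> : q != p by apply: contraL qd => /eqP->; rewrite mem_primes pd !andbF.
by [].
Qed.

(** For p the least prime factor of n, each divisor d prime to p cancels against p d, and multiples
    of p^2 contribute 0. *)
Lemma dsum_moebius n : (0 < n)%N -> dsum moebius n = (n == 1%N)%:R.
Proof.
move=> n0; case: eqVneq => [->|n1].
  by rewrite dsum1 moebius1.
have pp : prime (pdiv n) by rewrite pdiv_prime // ltn_neqAle eq_sym n1.
set p := pdiv n in pp *; have pn : (p %| n)%N := pdiv_dvd n.
rewrite (dsum_split_prime _ pp n0 pn).
rewrite [X in _ + X](_ : _ = - \sum_(1 <= d < n.+1 | (d %| n %/ p)%N && ~~ (p %| d)%N) moebius d).
  by rewrite subrr.
rewrite (@dsum_widen _ _ _ n); last first.
  by rewrite divn_gt0 ?prime_gt0 // dvdn_leq //= leq_div.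
rewrite -sumrN [RHS]big_mkcondr /= big_nat_cond [RHS]big_nat_cond.
apply: eq_bigr => d /andP[/andP[d0 _] _].
by rewrite moebius_prime_mul //; case: (p %| d)%N.
Qed.

End Moebius.

Section VonMangoldt.
Variable R : realType.

(** Sums ln p over the representations n = p^k with k >= 1, of which there is at most one. As a
    double sum over a range that may be enlarged, it can be exchanged with a sum over n. *)
Definition mangoldt n : R :=
  \sum_(0 <= p < n.+1 | prime p) \sum_(1 <= k < n.+1 | n == (p ^ k)%N) ln p%:R.

Lemma ln_nat_ge0 n : 0 <= ln n%:R :> R.
Proof. by case: n => [|n]; [rewrite ln0 | rewrite ln_ge0 // ler1n]. Qed.

Lemma mangoldt_ge0 n : 0 <= mangoldt n.
Proof. by apply: sumr_ge0 => p _; apply: sumr_ge0 => k _; exact: ln_nat_ge0. Qed.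

Lemma mangoldt_widen n x : (0 < n <= x)%N -> mangoldt n =
  \sum_(0 <= p < x.+1 | prime p) \sum_(1 <= k < x.+1 | n == (p ^ k)%N) ln p%:R.
Proof.
case/andP=> n0 nx.
rewrite [RHS](@big_cat_nat _ _ _ n.+1) //= [X in _ = _ + X]big1_seq ?addr0; last first.
  move=> p /andP[pp]; rewrite mem_index_iota => /andP[np _].
  rewrite big1_seq // => k /andP[/eqP npk]; rewrite mem_index_iota => /andP[k0 _].
  move: np; rewrite npk ltnNge -{1}[p]expn1 leq_exp2l ?prime_gt1 //.
  by rewrite k0.
apply: eq_bigr => p pp; rewrite [RHS](@big_cat_nat _ _ _ n.+1) //= [X in _ = _ + X]big1_seq ?addr0 //.
move=> k /andP[/eqP npk]; rewrite mem_index_iota => /andP[nk _].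
by have := leq_ltn_trans (ltnW nk) (ltn_expl k (prime_gt1 pp)); rewrite -npk ltnn.
Qed.

Lemma ln_prod (I : Type) (r : seq I) (P : pred I) (F : I -> nat) :
  (forall i, P i -> (0 < F i)%N) ->
  ln (\prod_(i <- r | P i) F i)%:R = \sum_(i <- r | P i) ln (F i)%:R :> R.
Proof.
move=> F0; have : (0 < \prod_(i <- r | P i) F i)%N /\
  ln (\prod_(i <- r | P i) F i)%:R = \sum_(i <- r | P i) ln (F i)%:R :> R; last by case.
elim/big_rec2: _ => [|i x y Pi [x0 E]]; first by rewrite ln1.
rewrite muln_gt0 F0 //; split=> //.
by rewrite natrM lnM ?posrE ?ltr0n ?F0 // E.
Qed.

Lemma dsum_mangoldt n : (0 < n)%N -> dsum mangoldt n = ln n%:R.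
Proof.
move=> n0; rewrite /dsum.
transitivity (\sum_(0 <= p < n.+1 | prime p) \sum_(1 <= k < n.+1)
   if (p ^ k %| n)%N then ln p%:R else 0 : R).
  rewrite big_nat_cond (eq_bigr (fun d => \sum_(0 <= p < n.+1 | prime p)
      \sum_(1 <= k < n.+1 | d == (p ^ k)%N) ln p%:R)); last first.
    by move=> d /andP[/andP[d0 dn] _]; apply: mangoldt_widen; rewrite d0.
  rewrite -big_nat_cond exchange_big /=; apply: eq_bigr => p pp.
  rewrite (exchange_big_dep predT) //=; apply: eq_bigr => k _.
  case: ifP => pkn; last first.
    by rewrite big1 // => d /andP[dn /eqP dE]; rewrite -dE dn in pkn.
  have pk : (p ^ k)%N \in index_iota 1 n.+1.
    by rewrite mem_index_iota expn_gt0 prime_gt0 //= ltnS dvdn_leq.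
  rewrite (big_rem _ pk) /= pkn eqxx /= big1_seq ?addr0 // => d /andP[/andP[_ /eqP->]].
  by rewrite mem_rem_uniq ?iota_uniq // !inE eqxx.
have nE : n = (\prod_(0 <= p < n.+1 | prime p) p ^ logn p n)%N.
  rewrite -{1}(partnT n0) /partn [LHS]big_mkcond [RHS]big_mkcond; apply: eq_bigr => p _ /=.
  by case: ifP => // /negbT; rewrite lognE => /negbTE->.
rewrite [in RHS]nE ln_prod; last by move=> p pp; rewrite expn_gt0 prime_gt0.
apply: eq_bigr => p pp; rewrite natrX lnXn ?ltr0n ?prime_gt0 //.
rewrite -big_mkcond /= (eq_bigl (fun k => k <= logn p n)%N); last first.
  by move=> k; rewrite pfactor_dvdn.
have ln_n : (logn p n <= n)%N.
  by rewrite (leq_trans (ltnW (ltn_expl _ (prime_gt1 pp)))) // dvdn_leq // pfactor_dvdn.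
rewrite (@big_cat_nat _ _ _ (logn p n).+1) //= [X in _ + X]big1_seq ?addr0; last first.
  by move=> k /andP[kl]; rewrite mem_index_iota ltnNge kl.
rewrite big_nat_cond (eq_bigl (fun k => 1 <= k < (logn p n).+1)%N); last first.
  by move=> k; rewrite ltnS; case: (k <= _)%N; rewrite ?andbF ?andbT.
rewrite -[LHS](eq_bigl _ _ (fun k => andbT _)) -big_nat_cond.
by rewrite sumr_const_nat subn1.
Qed.

(** Since ln n - ln d = ln(n / d) is a divisor sum of Lambda, exchanging the sums leaves the divisor
    sum of the Moebius function over n / k, which is 0 unless k = n. The extra term, ln n times the
    divisor sum of the Moebius function over n, is 0 for n = 1 by the first factor and otherwise by
    the second. *)
Lemma dsum_moebius_ln n : (0 < n)%N ->
  dsum (fun d => moebius R d * ln d%:R) n = - mangoldt n.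
Proof.
move=> n0.
have E : dsum (fun d => moebius R d * (ln n%:R - ln d%:R)) n = mangoldt n.
  transitivity (dsum (fun d => dsum (fun k => moebius R d * mangoldt k) (n %/ d)) n).
    rewrite /dsum big_nat_cond [RHS]big_nat_cond; apply: eq_bigr => d /andP[/andP[d0 dn] ddn].
    rewrite -big_distrr /= -/(dsum _ _) dsum_mangoldt ?divn_gt0 ?d0 //; congr (_ * _).
    rewrite -{1}(divnK ddn) natrM lnM ?posrE ?ltr0n ?divn_gt0 //.
    by rewrite addrK.
  rewrite dsum_assoc // /dsum (big_rem n) /=; last by rewrite mem_index_iota n0 /=.
  rewrite dvdnn divnn n0 -big_distrl /= -/(dsum _ _) dsum_moebius // eqxx mul1r.
  rewrite big1_seq ?addr0 // => k /andP[kn].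
  rewrite mem_rem_uniq ?iota_uniq // inE mem_index_iota => /andP[/= nk /andP[k0 _]].
  rewrite -big_distrl /= -/(dsum _ _) dsum_moebius; last by rewrite divn_gt0 // (dvdn_leq n0 kn).
  case: eqP => [E|]; last by rewrite mul0r.
  by move: nk; rewrite -(divnK kn) E mul1n eqxx.
rewrite -E -[RHS]addr0 -(mulr0 (ln n%:R)).
case: (eqVneq n 1%N) => [->|n1].
  by rewrite !dsum1 !subrr ln1 !mulr0 oppr0 addr0.
have := dsum_moebius R n0; rewrite (negbTE n1) mulr0n => <-.
rewrite /dsum big_distrr /= -sumrN -big_split /=; apply: eq_bigr => d _; ring.
Qed.

End VonMangoldt.

(** * Chebyshev, Mertens and Selberg estimates *)

Section ChebyshevMertens.
Variable R : realType.
Local Notation Lam := (@mangoldt R).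

Lemma ln_fact x : ln x`!%:R = \sum_(1 <= n < x.+1) ln n%:R :> R.
Proof.
rewrite fact_prod big_nat_cond ln_prod -?big_nat_cond //.
by move=> n /andP[/andP[]].
Qed.

(** Legendre's formula: [x %/ d] of the integers from 1 to x are multiples of d. *)
Lemma ln_fact_mangoldt x :
  ln x`!%:R = \sum_(1 <= d < x.+1) Lam d * (x %/ d)%:R.
Proof.
rewrite ln_fact.
transitivity (\sum_(1 <= n < x.+1) dsum (fun d => Lam d) n).
  by apply: eq_big_nat => n /andP[n0 _]; rewrite dsum_mangoldt.
rewrite (@sum_dsum _ (fun d _ => Lam d)); apply: eq_bigr => d _.
by rewrite sumr_const_nat subn1 mulr_natr.
Qed.

Definition psi x : R := \sum_(1 <= d < x.+1) Lam d.

Lemma psi_le x y : (x <= y)%N -> psi x <= psi y.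
Proof.
move=> xy; rewrite /psi [leRHS](@big_cat_nat _ _ _ x.+1) //= lerDl.
by apply: sumr_ge0 => d _; exact: mangoldt_ge0.
Qed.

Lemma ln_le_nat m n : (0 < m <= n)%N -> ln m%:R <= ln n%:R :> R.
Proof.
case/andP=> m0 mn; rewrite ler_ln ?posrE ?ltr0n ?ler_nat //.
exact: leq_trans mn.
Qed.

(** In ln C(2n, n), Legendre's formula gives Lambda(d) the coefficient floor(2n/d) - 2 floor(n/d),
    which is nonnegative and at least 1 for n < d <= 2n, while C(2n, n) <= 2^(2n) has logarithm at
    most 2n. *)
Lemma psi_double n : psi n.*2 <= psi n + n.*2%:R.
Proof.
have -> : psi n.*2 = psi n + \sum_(n.+1 <= d < n.*2.+1) Lam d.
  by rewrite /psi (@big_cat_nat _ _ _ n.+1 1) //= ltnS -addnn leq_addr.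
rewrite lerD2l.
have bin_le : ln 'C(n.*2, n)%:R <= n.*2%:R :> R.
  have b0 : (0 < 'C(n.*2, n))%N by rewrite bin_gt0 -addnn leq_addr.
  have bl : ('C(n.*2, n) <= 2 ^ n.*2)%N.
    have n2 : (n < n.*2.+1)%N by rewrite ltnS -addnn leq_addr.
    rewrite -[2%N]/(1 + 1)%N expnDn (bigD1 (Ordinal n2)) //= !exp1n !muln1.
    exact: leq_addr.
  apply: le_trans (_ : ln (2 ^ n.*2)%:R <= _); first by rewrite ln_le_nat // b0.
  rewrite natrX lnXn // -[leLHS]mulr_natr ler_piMl ?ler0n //.
  by rewrite (le_trans (@le_ln1Dx R 1 _)) //; lra.
apply: le_trans bin_le.
have -> : ln 'C(n.*2, n)%:R = ln n.*2`!%:R - ln n`!%:R *+ 2 :> R.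
  have n2 : (n <= n.*2)%N by rewrite -addnn leq_addr.
  rewrite -(bin_fact n2) -addnn addnK !natrM !lnM ?posrE ?mulr_gt0 ?ltr0n ?fact_gt0 //.
    by rewrite addrA mulr2n opprD addrA !addrK.
  by rewrite bin_gt0 leq_addr.
rewrite !ln_fact_mangoldt.
have E : \sum_(1 <= d < n.+1) Lam d * (n %/ d)%:R =
         \sum_(1 <= d < n.*2.+1) Lam d * (n %/ d)%:R.
  rewrite [RHS](@big_cat_nat _ _ _ n.+1) //=; last by rewrite ltnS -addnn leq_addr.
  rewrite [X in _ = _ + X]big1_seq ?addr0 // => d /andP[_].
  by rewrite mem_index_iota => /andP[nd _]; rewrite divn_small // mulr0.
rewrite E -sumrMnl -sumrB [leRHS](@big_cat_nat _ _ _ n.+1) //=; last first.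
  by rewrite ltnS -addnn leq_addr.
rewrite -[leLHS]add0r; apply: lerD.
  apply: sumr_ge0 => d _; rewrite -mulrnAr -mulrBr mulr_ge0 ?mangoldt_ge0 //.
  rewrite subr_ge0 -mulr_natl -natrM ler_nat.
  case: d => [|d]; first by rewrite !divn0 muln0.
  by rewrite leq_divRL // -mulnA -mul2n leq_mul2l leq_trunc_div orbT.
rewrite big_nat_cond [leRHS]big_nat_cond.
apply: ler_sum => d /andP[/andP[nd dn] _].
have -> : (n %/ d = 0)%N by rewrite divn_small.
rewrite mulr0 mul0rn subr0 ler_peMr ?mangoldt_ge0 // ler1n divn_gt0 //.
exact: leq_ltn_trans nd.
Qed.

Lemma chebyshev x : psi x <= 4 * x%:R.
Proof.
elim/ltn_ind: x => x IH.
have [x1|x1] := leqP x 1.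
  apply: le_trans (psi_le x1) _.
  rewrite /psi big_nat1 /mangoldt big1 ?mulr_ge0 ?ler0n // => p pp.
  rewrite big1_seq // => k /andP[/eqP E]; rewrite mem_index_iota => /andP[k0 _].
  have := ltn_expl k (prime_gt1 pp); rewrite -E; case: k k0 {E} => //.
have n0 : (0 < uphalf x)%N by rewrite uphalf_gt0; lia.
have xu : (x <= (uphalf x).*2)%N by rewrite uphalfE; lia.
have xu2 : ((uphalf x).*2 <= x.+1)%N by rewrite uphalfE; lia.
have ux : (uphalf x < x)%N by lia.
apply: le_trans (psi_le xu) _; apply: le_trans (psi_double _) _.
apply: le_trans (lerD (IH _ ux) (lexx _)) _.
(* This asks 4 u + 2 u <= 4 x for u = ceil(x / 2); it is an equality at x = 3, whence the constant
   4. *)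
rewrite -!natrM -natrD ler_nat; lia.
Qed.

(** As x / d <= floor(x / d) + 1, x times the sum is at most ln x! + psi(x), hence at most x ln x +
    4 x. *)
Lemma mertens_upper x : (0 < x)%N ->
  \sum_(1 <= d < x.+1) Lam d / d%:R <= ln x%:R + 4.
Proof.
move=> x0; have x0R : 0 < x%:R :> R by rewrite ltr0n.
rewrite -(ler_pM2l x0R) mulrDr (mulrC _ 4) big_distrr /=.
apply: le_trans (_ : ln x`!%:R + psi x <= _); last first.
  apply: lerD; last exact: chebyshev.
  rewrite mulr_natl -[X in _ <= _ *+ X](subn1 x.+1) -sumr_const_nat ln_fact.
  by apply: ler_sum_nat => n /andP[n0 nx]; apply: ln_le_nat; rewrite n0.
rewrite ln_fact_mangoldt /psi -big_split /=; apply: ler_sum_nat => d /andP[d0 dx].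
rewrite mulrCA -[X in _ + X]mulr1 -mulrDr ler_wpM2l ?mangoldt_ge0 //.
rewrite ler_pdivrMr ?ltr0n // natr1 -natrM ler_nat.
have := divn_eq x d; have := ltn_pmod x d0; nia.
Qed.

Lemma ln_fact_lower x : (0 < x)%N -> x%:R * ln x%:R - x%:R <= ln x`!%:R :> R.
Proof.
elim: x => // x IH _; case: x IH => [_|x /(_ isT) IH].
  by rewrite factS fact0 muln1 ln1 mulr0 sub0r; lra.
have y0 : 0 < x.+1%:R :> R by rewrite ltr0n.
rewrite factS natrM lnM ?posrE ?ltr0n ?fact_gt0 //.
have : ln x.+2%:R <= ln x.+1%:R + x.+1%:R^-1 :> R.
  have -> : x.+2%:R = x.+1%:R * (1 + x.+1%:R^-1) :> R.
    by rewrite mulrDr mulr1 divff ?gt_eqF // -[x.+2]addn1 natrD.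
  have i0 : 0 < x.+1%:R^-1 :> R by rewrite invr_gt0.
  rewrite lnM ?posrE //; last by rewrite addr_gt0.
  by rewrite lerD2l le_ln1Dx // (lt_trans _ i0) //; lra.
rewrite -(ler_pM2l y0) mulrDr divff ?gt_eqF //.
rewrite -[x.+2]addn1 natrD; move: IH; set a := ln _; set b := ln _; set c := ln _.
by move=> IH H; lra.
Qed.

(* The weights [mu(d) ln(x/d)] isolate [e(1) ln x + sum_n e(n) Lambda(n)/n], and
   the decay of the inner sums makes the total bounded. *)
Lemma selberg_asymptotic (e : nat -> R) (C : R) : 0 <= C ->
  (forall d x, (0 < d)%N -> `|hsum (fun m => e (d * m)%N) x| <= C / x.+1%:R) ->
  forall x, (0 < x)%N ->
    `|\sum_(1 <= n < x.+1) e n * Lam n / n%:R + e 1%N * ln x%:R| <= C.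
Proof.
move=> C0 eC x x0; have x0R : 0 < x%:R :> R by rewrite ltr0n.
pose F d m := moebius R d * (ln x%:R - ln d%:R) * (e (d * m)%N / (d * m)%:R).
have -> : \sum_(1 <= n < x.+1) e n * Lam n / n%:R + e 1%N * ln x%:R =
   \sum_(1 <= d < x.+1) \sum_(1 <= m < (x %/ d).+1) F d m.
  rewrite -sum_dsum.
  transitivity (\sum_(1 <= n < x.+1) (e n * Lam n / n%:R
      + (n == 1%N)%:R * e n * ln x%:R)).
    rewrite big_split /=; congr (_ + _).
    rewrite big_ltn // eqxx mul1r big1_seq ?addr0 // => n /andP[_].
    by rewrite mem_index_iota => /andP[n1 _]; rewrite (gtn_eqF n1) !mul0r.
  apply: eq_big_nat => n /andP[n0 _].
  transitivity (e n / n%:R * (ln x%:R * dsum (moebius R) n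
      - dsum (fun d => moebius R d * ln d%:R) n)).
    rewrite dsum_moebius_ln // dsum_moebius // opprK.
    have bn : (n == 1%N)%:R / n%:R = (n == 1%N)%:R :> R.
      by case: eqVneq => [->|_]; rewrite ?divr1 ?mul0r.
    by rewrite -{1}bn; ring.
  rewrite /dsum big_distrr /= -sumrB big_distrr /=; apply: eq_bigr => d dn.
  by rewrite /F (mulnC d) divnK //; ring.
apply: le_trans (ler_norm_sum _ _ _) _.
(* The decay bounds the term of d by ln(x/d) (C d / x) / d, and ln x! >= x ln x - x makes the total
   of (C / x) ln(x/d) at most C. *)
apply: le_trans (_ : \sum_(1 <= d < x.+1) C / x%:R * (ln x%:R - ln d%:R) <= _).
  apply: ler_sum_nat => d /andP[d0 dx]; rewrite ltnS in dx.
  have d0R : 0 < d%:R :> R by rewrite ltr0n.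
  have -> : \sum_(1 <= m < (x %/ d).+1) F d m = moebius R d *
      ((ln x%:R - ln d%:R) * (hsum (fun m => e (d * m)%N) (x %/ d) / d%:R)).
    rewrite /hsum big_distrl /= big_distrr /= big_distrr /=.
    apply: eq_big_nat => m /andP[m0 _]; rewrite /F natrM invfM; ring.
  have l0 : 0 <= ln x%:R - ln d%:R :> R by rewrite subr_ge0 ln_le_nat // d0.
  rewrite normrM -[leRHS]mul1r; apply: ler_pM => //; first exact: norm_moebius.
  rewrite normrM (ger0_norm l0) mulrC; apply: ler_wpM2r => //.
  rewrite normrM normfV (gtr0_norm d0R) ler_pdivrMr //.
  apply: le_trans (eC _ _ d0) _; rewrite -mulrA; apply: ler_wpM2l => //.
  rewrite -[leLHS]mul1r ler_pdivrMr ?ltr0n // -mulrA mulrC ler_pdivlMr // mul1r.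
  rewrite -natrM ler_nat; have := divn_eq x d; have := ltn_pmod x d0; nia.
rewrite -big_distrr /= sumrB -ln_fact sumr_const_nat subn1 /=.
rewrite mulrAC ler_pdivrMr //; apply: ler_wpM2l => //.
by have := ln_fact_lower x0; rewrite -mulr_natl; lra.
Qed.

End ChebyshevMertens.

(** * Monsky's argument for real characters *)

Section RealCharacter.
Variable R : realType.

Section DivisorSumsOfSigns.
Variable e : nat -> R.
Hypothesis e1 : e 1%N = 1.
Hypothesis eM : forall m n, e (m * n)%N = e m * e n.
Hypothesis esign : forall n, [\/ e n = 0, e n = 1 | e n = -1].

Lemma sign_geometric n k : 0 <= \sum_(0 <= j < k.+1) e n ^+ j /\
  (~~ odd k -> 1 <= \sum_(0 <= j < k.+1) e n ^+ j).
Proof.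
rewrite big_nat_recl //= expr0.
case: (esign n) => ->.
- rewrite big1_seq ?addr0; last by move=> i _; rewrite expr0n.
  by split=> //; exact: ler01.
- rewrite (eq_bigr (fun=> 1)) ?sumr_const_nat; last by move=> i _; rewrite expr1n.
  by split=> [|_]; rewrite ?lerDl ?addr_ge0 // mulrn_wge0.
- have -> : \sum_(0 <= i < k) (-1) ^+ i.+1 = - (odd k)%:R :> R.
    elim: k => [|k IH]; first by rewrite big_geq // oppr0.
    rewrite big_nat_recr //= IH exprS -signr_odd; case: (odd k) => /=; ring.
  by case: (odd k) => /=; split=> //; rewrite ?subrr ?subr0.
Qed.

Lemma dsum_char_prime_power p m k : prime p -> (0 < m)%N -> ~~ (p %| m)%N ->
  dsum e (p ^ k * m) = (\sum_(0 <= j < k.+1) e p ^+ j) * dsum e m.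
Proof.
move=> pp m0 pm; have p0 := prime_gt0 pp.
elim: k => [|k IH]; first by rewrite mul1n big_nat1 expr0 mul1r.
have n0 : (0 < p ^ k.+1 * m)%N by rewrite muln_gt0 expn_gt0 p0.
have pn : (p %| p ^ k.+1 * m)%N by rewrite expnS -mulnA dvdn_mulr.
rewrite (dsum_split_prime _ pp n0 pn).
have -> : (p ^ k.+1 * m %/ p = p ^ k * m)%N by rewrite expnS -mulnA mulKn.
have -> : dsum (fun d => e (p * d)%N) (p ^ k * m) = e p * dsum e (p ^ k * m).
  by rewrite /dsum big_distrr /=; apply: eq_bigr => d _; rewrite eM.
rewrite IH [in RHS]big_nat_recl //= expr0 mulrDl mul1r; congr (_ + _); last first.
  by rewrite mulrA; congr (_ * _); rewrite big_distrr /=; apply: eq_bigr => j _; rewrite exprS.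
rewrite (@dsum_widen _ _ m (p ^ k.+1 * m)); last by rewrite m0 leq_pmull // expn_gt0 p0.
apply: eq_bigl => d; have [pd|pd] := boolP (p %| d)%N; rewrite ?andbF ?andbT.
  by apply/esym; apply: contraNF pm; apply: dvdn_trans.
by rewrite Gauss_dvdr // coprime_sym coprimeXl // prime_coprime.
Qed.

(** [dsum e] is multiplicative, with value 1 + e(p) + ... + e(p)^k at p^k; for e(p) in {0, 1, -1}
    this is nonnegative, and at least 1 for even k. The parity condition singles out the squares. *)
Lemma dsum_char_sign n : (0 < n)%N -> 0 <= dsum e n /\
  ((forall p, ~~ odd (logn p n)) -> 1 <= dsum e n).
Proof.
elim/ltn_ind: n => n IH n0; have [n1|n1] := leqP n 1.
  have -> : n = 1%N by apply/eqP; rewrite eqn_leq n1.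
  by rewrite dsum1 e1; split=> //; exact: ler01.
have pp := pdiv_prime n1; set p := pdiv n in pp.
have [m pm nE] := pfactor_coprime pp n0; set k := logn p n in nE.
have k0 : (0 < k)%N by rewrite logn_gt0 mem_primes pp n0 pdiv_dvd.
have m0 : (0 < m)%N by move: n0; rewrite nE muln_gt0 => /andP[].
have mn : (m < n)%N.
  rewrite nE -{1}[m]muln1 ltn_pmul2l //.
  by apply: leq_ltn_trans k0 (ltn_expl _ (prime_gt1 pp)).
have pndm : ~~ (p %| m)%N by rewrite -prime_coprime.
have nE' : dsum e n = (\sum_(0 <= j < k.+1) e p ^+ j) * dsum e m.
  by rewrite [in LHS]nE mulnC dsum_char_prime_power.
have [IH1 IH2] := IH m mn m0; have [G1 G2] := sign_geometric p k.
rewrite nE'; split; first exact: mulr_ge0.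
move=> ev; rewrite -[leLHS]mulr1; apply: (ler_pM ler01 ler01 (G2 (ev p))).
apply: IH2 => q; have [->|qp] := eqVneq q p.
  suff -> : logn p m = 0%N by [].
  by apply/eqP; rewrite -leqn0 leqNgt logn_gt0 mem_primes (negbTE pndm) !andbF.
have := ev q; rewrite nE lognM ?expn_gt0 ?(prime_gt0 pp) // lognX (logn_prime _ pp).
by rewrite (negbTE qp) muln0 addn0.
Qed.

End DivisorSumsOfSigns.

Section MonskyCoefficients.
Variables (u : R).
Hypotheses (u0 : 0 < u) (u1 : u < 1).
Let t := u ^+ 2.

Let t0 : 0 < t. Proof. by rewrite exprn_gt0. Qed.
Let t1 : t < 1. Proof. by rewrite expr_lt1 // ltW. Qed.

(** Weighted AM-GM for 1 and n copies of u^(n+1). Working with the square root u of t makes the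
    geometric mean u^n of 1, t, ..., t^n, on which [geo_ge] rests, a natural power. *)
Lemma weighted_amgm n : n.+1%:R * u ^+ n <= 1 + n%:R * u ^+ n.+1.
Proof.
elim: n => [|n IH]; first by rewrite !mul1r mul0r addr0 expr0.
have un1 : u ^+ n.+1 <= 1 by rewrite exprn_ile1 // ltW.
have H : 0 <= (1 - u) * (1 - u ^+ n.+1) by rewrite mulr_ge0 // subr_ge0 // ltW.
have H2 := ler_wpM2l (ltW u0) IH.
have E1 : u ^+ n.+1 = u * u ^+ n by rewrite exprS.
have E2 : u ^+ n.+2 = u * (u * u ^+ n) by rewrite !exprS.
rewrite -(natr1 n.+1) -(natr1 n) in H2 *.
rewrite E1 in H H2; rewrite E1 E2; lra.
Qed.

Definition geo n : R := \sum_(0 <= i < n) t ^+ i.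

Lemma geoS n : geo n.+1 = 1 + t * geo n.
Proof.
rewrite /geo big_nat_recl // expr0 big_distrr /=; congr (_ + _).
by apply: eq_bigr => i _; rewrite exprS.
Qed.

Lemma geoSr n : geo n.+1 = geo n + t ^+ n.
Proof. by rewrite /geo big_nat_recr. Qed.

Lemma geoE n : (1 - t) * geo n = 1 - t ^+ n.
Proof. by elim: n => [|n IH]; rewrite ?geoSr ?mulrDr ?IH /geo ?big_geq // ?exprS; ring. Qed.

Lemma geo_ge n : n.+1%:R * u ^+ n <= geo n.+1.
Proof.
elim: n => [|n IH]; first by rewrite /geo big_nat1 !expr0 mulr1.
apply: le_trans (weighted_amgm _) _; rewrite geoS lerD2l.
have := ler_wpM2l (ltW t0) IH; rewrite /t !exprS expr0 => H.
by apply: le_trans H; rewrite le_eqVlt; apply/orP; left; apply/eqP; ring.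
Qed.

Lemma geo_gt0 n : 0 < geo n.+1.
Proof. by apply: lt_le_trans (geo_ge n); rewrite mulr_gt0 ?ltr0n ?exprn_gt0. Qed.

(* [(1 - t)] times Monsky's [1/(n(1-t)) - t^n/(1-t^n)]. *)
Definition monsky n : R := n%:R^-1 - t ^+ n / geo n.

Lemma monsky_ge0 n : 0 <= monsky n.+1.
Proof.
rewrite subr_ge0 ler_pdivrMr ?geo_gt0 // mulrC ler_pdivlMr ?ltr0n //.
apply: le_trans (geo_ge n); rewrite mulrC ler_wpM2l //.
rewrite /t -exprM; apply: ler_wiXn2l; rewrite ?ltW //; lia.
Qed.

(** Clearing denominators with geo(n+2) - t geo(n+1) = 1 leaves geo(n+1) geo(n+2) >= (n+1)(n+2)
    t^(n+1); [geo_ge] gives even u^(2n+1) in place of t^(n+1) = u^(2n+2). *)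
Lemma monsky_decreasing n : monsky n.+2 <= monsky n.+1.
Proof.
have g1 := geo_gt0 n; have g2 := geo_gt0 n.+1.
have a0 : 0 < n.+1%:R :> R by rewrite ltr0n.
have b0 : 0 < n.+2%:R :> R by rewrite ltr0n.
have E : monsky n.+1 - monsky n.+2 =
  (geo n.+1 * geo n.+2 - n.+1%:R * n.+2%:R * t ^+ n.+1) /
    (n.+1%:R * n.+2%:R * (geo n.+1 * geo n.+2)).
  have H : geo n.+2 - t * geo n.+1 = 1 by rewrite (geoS n.+1) addrK.
  have -> : geo n.+1 * geo n.+2 - n.+1%:R * n.+2%:R * t ^+ n.+1 =
    (n.+2%:R - n.+1%:R) * geo n.+1 * geo n.+2 -
      n.+1%:R * n.+2%:R * t ^+ n.+1 * (geo n.+2 - t * geo n.+1).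
    by rewrite H -(natr1 n.+1); ring.
  rewrite /monsky [t ^+ n.+2]exprS.
  by move: (n.+1%:R) (n.+2%:R) a0 b0 => a b a0 b0; field; rewrite !gt_eqF.
rewrite -subr_ge0 E; apply: divr_ge0; last by rewrite !mulr_ge0 // ltW.
rewrite subr_ge0.
have P k : 0 <= k.+1%:R * u ^+ k by rewrite mulr_ge0 // exprn_ge0 // ltW.
apply: le_trans (ler_pM (P _) (P _) (geo_ge n) (geo_ge n.+1)).
rewrite mulrACA; apply: ler_wpM2l; first by rewrite mulr_ge0 ?ltW.
rewrite -exprD /t -exprM; apply: ler_wiXn2l; rewrite ?ltW //; lia.
Qed.

Lemma monsky1 : monsky 1 = 1 - t.
Proof. by rewrite /monsky /geo big_nat1 expr0 expr1 invr1 mulr1. Qed.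

End MonskyCoefficients.

Lemma square_subsum_le (a : nat -> R) M : (forall n, 0 <= a n) ->
  \sum_(1 <= m < M.+1) a (m ^ 2)%N <= \sum_(1 <= n < (M ^ 2).+1) a n.
Proof.
move=> a0; elim: M => [|M IH]; first by rewrite !big_geq.
rewrite big_nat_recr //= [leRHS](@big_cat_nat _ _ _ (M ^ 2).+1) //=; last first.
  by rewrite ltnS leq_exp2r.
apply: lerD => //; rewrite big_nat_recr /=; last by rewrite ltn_exp2r.
by rewrite lerDr sumr_ge0.
Qed.

Lemma archi_nat (x : R) : exists n : nat, x < n%:R.
Proof. by exists (Num.bound `|x|); apply: le_lt_trans (ler_norm x) (archi_boundP (normr_ge0 x)). Qed.

Lemma expr_decay (q : R) Y : 0 < q < 1 -> (1 - q) ^+ Y * (1 + Y%:R * q) <= 1.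
Proof.
case/andP=> q0 q1; elim: Y => [|Y IH]; first by rewrite expr0 mul0r addr0 mulr1.
apply: le_trans IH; rewrite exprSr -mulrA; apply: ler_wpM2l.
  by rewrite exprn_ge0 // subr_ge0 ltW.
rewrite -natr1; have : 0 <= Y%:R * (q * q) by rewrite !mulr_ge0 // ltW.
have : 0 <= q * q by rewrite mulr_ge0 // ltW.
by lra.
Qed.

(* Monsky's argument: [sum_d e(d) t^d/(1-t^d)] would stay bounded as [t -> 1],
   yet its power series has nonnegative coefficients, at least [1] at squares. *)
Lemma real_character_nonvanishing N (e : nat -> R) : (0 < N)%N ->
  per N e -> \sum_(0 <= n < N) e n = 0 -> e 1%N = 1 ->
  (forall m n, e (m * n)%N = e m * e n) ->
  (forall n, [\/ e n = 0, e n = 1 | e n = -1]) -> ~ vanishing e.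
Proof.
move=> N0 pe e0 e1 eM es [C C0 HC].
have [B B0 HB] := per_sum_bound N0 pe e0.
have r0 n : (0 < n)%N -> 0 <= dsum e n by move=> n0; have [] := dsum_char_sign e1 eM es n0.
have rsq m : (0 < m)%N -> 1 <= dsum e (m ^ 2).
  move=> m0; have [|_ H] := dsum_char_sign e1 eM es (n := (m ^ 2)%N).
    by rewrite expn_gt0 m0.
  by apply: H => p; rewrite lognX mul2n odd_double.
have abse n : `|e n| <= 1 by case: (es n) => ->; rewrite ?normrN ?normr0 ?normr1.
(* The squares up to M^2 will contribute at least M / 2 to the power series, more than its upper
   bound B + 2. *)
have [M HM] := archi_nat (2 * (B + 2)).
have M0 : (0 < M)%N by rewrite -(ltr_nat R); apply: le_lt_trans HM; rewrite mulr_ge0 ?addr_ge0.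
have M0R : 0 < M%:R :> R by rewrite ltr0n.
(* With t = (1 - v)^2, Bernoulli's inequality gives t^(m^2) >= 1 - 2 m^2 v >= 1/2 for all m <= M. *)
pose v : R := (4 * (M ^ 2)%:R)^-1.
have M2 : 1 <= (M ^ 2)%:R :> R by rewrite ler1n expn_gt0 M0.
have v0 : 0 < v by rewrite invr_gt0 mulr_gt0 // (lt_le_trans _ M2).
have v4 : v <= 4^-1 by rewrite lef_pV2 ?posrE; lra.
have vM : v * (M ^ 2)%:R = 4^-1 by rewrite /v invfM mulfVK // gt_eqF // (lt_le_trans _ M2).
pose u : R := 1 - v; have u0 : 0 < u by rewrite /u; lra.
have u1 : u < 1 by rewrite /u; lra.
pose t : R := u ^+ 2.
have t0 : 0 < t by rewrite exprn_gt0.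
have t1 : t < 1 by rewrite expr_lt1 // ltW.
pose q : R := 1 - t; have q0 : 0 < q by rewrite subr_gt0.
have q1 : q < 1 by rewrite /q; lra.
have lower X : (M ^ 2 <= X)%N -> M%:R / 2 <= \sum_(1 <= n < X.+1) dsum e n * t ^+ n.
  move=> MX; pose a n := if n == 0%N then 0 else dsum e n * t ^+ n.
  have a0 n : 0 <= a n.
    by rewrite /a; case: eqP => // /eqP n0; apply: mulr_ge0; [apply: r0; rewrite lt0n|rewrite exprn_ge0 // ltW].
  rewrite (eq_big_nat _ _ (F2 := a)); last by move=> n /andP[n0 _]; rewrite /a gtn_eqF.
  rewrite (@big_cat_nat _ _ _ (M ^ 2).+1) //= -[leLHS]addr0; apply: lerD; last exact: sumr_ge0.
  apply: le_trans (square_subsum_le _ a0).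
  rewrite [leLHS]mulr_natl -[X in _ *+ X <= _](subn1 M.+1) -sumr_const_nat.
  apply: ler_sum_nat => m /andP[m0 mM].
  rewrite /a gtn_eqF ?expn_gt0 ?m0 // -[leLHS]mul1r; apply: (ler_pM ler01 _ (rsq _ m0)); first by rewrite invr_ge0.
  have bern (n : nat) (w : R) : 0 <= w <= 1 -> 1 - n%:R * w <= (1 - w) ^+ n.
    case/andP=> w0 w1; elim: n => [|n IH]; first by rewrite mul0r subr0 expr0.
    have /(ler_wpM2l _) := IH => /(_ (1 - w)); rewrite subr_ge0 => /(_ w1).
    rewrite -exprS; apply: le_trans; rewrite -natr1.
    have : 0 <= n%:R * (w * w) by rewrite !mulr_ge0.
    by lra.
  rewrite /t -exprM; apply: le_trans (bern _ _ _); last by rewrite ltW //=; lra.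
  have : (m ^ 2)%:R * v <= 4^-1.
    by rewrite -vM mulrC; apply: (ler_wpM2l (ltW v0)); rewrite ler_nat leq_exp2r // -ltnS.
  rewrite natrM; lra.
(* For each d, q t^d / (1 - t^d) = 1/d - [monsky u d]. The 1/d part is small as [e] is vanishing,
   the [monsky] part is at most B times [monsky u 1] = q by Abel summation, and truncating the
   geometric series costs at most t^X for each d. *)
have upper X : (0 < X)%N -> q * \sum_(1 <= n < X.+1) dsum e n * t ^+ n <=
    C / X.+1%:R + B * q + X%:R * t ^+ X.
  move=> X0.
  have -> : \sum_(1 <= n < X.+1) dsum e n * t ^+ n =
      \sum_(1 <= d < X.+1) \sum_(1 <= m < (X %/ d).+1) e d * t ^+ (d * m).
    rewrite -(sum_dsum (fun d m => e d * t ^+ (d * m))); apply: eq_bigr => n _.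
    rewrite /dsum big_distrl /=; apply: eq_bigr => d dn.
    by rewrite mulnC divnK.
  have E d : (0 < d)%N -> q * \sum_(1 <= m < (X %/ d).+1) e d * t ^+ (d * m) =
      e d / d%:R - e d * monsky u d - e d * t ^+ (d * (X %/ d).+1) / geo u d.
    case: d => // d _; have g0 := geo_gt0 u0 u1 d.
    have td : t ^+ d.+1 = 1 - q * geo u d.+1 by rewrite /q /t geoE; ring.
    rewrite -big_distrr /=.
    have S : (1 - t ^+ d.+1) * \sum_(1 <= m < (X %/ d.+1).+1) t ^+ (d.+1 * m) =
       t ^+ d.+1 - t ^+ (d.+1 * (X %/ d.+1).+1).
      elim: (X %/ d.+1)%N => [|k IH]; first by rewrite big_geq // mulr0 muln1 subrr.
      rewrite big_nat_recr //= mulrDr IH (mulnS _ k.+1) exprD; ring.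
    have -> : q * (e d.+1 * \sum_(1 <= m < (X %/ d.+1).+1) t ^+ (d.+1 * m)) =
       e d.+1 * ((1 - t ^+ d.+1) * \sum_(1 <= m < (X %/ d.+1).+1) t ^+ (d.+1 * m)) / geo u d.+1.
      rewrite {1}td; field; by rewrite gt_eqF.
    rewrite S /monsky -/t; ring.
  rewrite big_distrr /= (eq_big_nat _ _ (F2 := fun d => e d / d%:R - e d * monsky u d
     - e d * t ^+ (d * (X %/ d).+1) / geo u d)); last by move=> d /andP[d0 _]; exact: E.
  rewrite !sumrB; apply: lerD; first apply: lerD.
  - by apply: le_trans (HC X); rewrite ler_norm.
  - apply: le_trans (ler_norm _) _; rewrite normrN.
    rewrite /q -(monsky1 u); apply: abel_summation => [n n1|[|n]//|[|n]//].
    + exact: HB.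
    + by move=> _; apply: monsky_ge0.
    + by move=> _; apply: monsky_decreasing.
  - apply: le_trans (ler_norm _) _; rewrite normrN; apply: le_trans (ler_norm_sum _ _ _) _.
    rewrite mulr_natl -[X in _ <= _ *+ X](subn1 X.+1) -sumr_const_nat.
    apply: ler_sum_nat => -[//|d] /andP[_ dX].
    rewrite !normrM normfV (gtr0_norm (geo_gt0 u0 u1 d)) (@ger0_norm _ (t ^+ _)); last by rewrite exprn_ge0 // ltW.
    have g1 : 1 <= geo u d.+1.
      rewrite geoS lerDl; apply: mulr_ge0; first exact: ltW.
      by apply: sumr_ge0 => i _; rewrite !exprn_ge0 // ltW.
    rewrite ler_pdivrMr ?geo_gt0 // [leRHS]mulrC; apply: ler_pM => //.
    - by rewrite exprn_ge0 // ltW.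
    - exact: le_trans g1.
    - by apply: (ler_wiXn2l (ltW t0) (ltW t1)); rewrite mulnC ltnW // ltn_ceil.
(* At X = 2 Y both error terms are at most q: C / (X + 1) because Y > C / q, and X t^X because
   t^(2Y) <= (Y q)^(-2) and Y > 2 / q^3. *)
have [Y HY] := archi_nat (C / q + 2 / q ^+ 3 + (M ^ 2)%:R + 1).
have q30 : 0 < 2 / q ^+ 3 by rewrite divr_gt0 // exprn_gt0.
have Cq0 : 0 <= C / q by rewrite divr_ge0 // ltW.
have Y1 : 1 < Y%:R :> R by lra.
have Y0R : 0 < Y%:R :> R by lra.
have MY : (M ^ 2 <= Y.*2)%N by rewrite -(ler_nat R) -mul2n natrM; lra.
have X0 : (0 < Y.*2)%N by rewrite double_gt0 -(ltr0n R).
have := upper _ X0; have := lower _ MY; move: (\sum_(_ <= _ < _) _) => S SM qS.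
have T1 : C / Y.*2.+1%:R <= q.
  rewrite ler_pdivrMr ?ltr0n // -ler_pdivrMl // mulrC.
  by rewrite -natr1 -mul2n natrM; lra.
have T2 : Y.*2%:R * t ^+ Y.*2 <= q.
  have D : t ^+ Y <= (Y%:R * q)^-1.
    rewrite -[leRHS]mul1r ler_pdivlMr ?mulr_gt0 //.
    apply: le_trans (@expr_decay q Y _); last by rewrite q0.
    have -> : 1 - q = t by rewrite /q; ring.
    by apply: ler_wpM2l; [rewrite exprn_ge0 // ltW | rewrite lerDr].
  have D2 : t ^+ Y.*2 <= (Y%:R * q)^-1 ^+ 2.
    rewrite -addnn exprD expr2; by apply: ler_pM => //; rewrite exprn_ge0 // ltW.
  apply: le_trans (ler_wpM2l (ler0n _ _) D2) _.
  have -> : Y.*2%:R * (Y%:R * q)^-1 ^+ 2 = (2 / q ^+ 3) * q / Y%:R.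
    by rewrite -mul2n natrM; field; rewrite !gt_eqF.
  rewrite ler_pdivrMr // mulrC; apply: (ler_wpM2l (ltW q0)); lra.
have : q * S <= q * (B + 2).
  apply: le_trans qS _; have -> : q * (B + 2) = q + B * q + q by ring.
  by rewrite lerD // lerD.
rewrite ler_pM2l // => SB; lra.
Qed.

End RealCharacter.

(** * Concentration of the mass of Lambda(n)/n *)

Section Nonvanishing.
Variable R : realType.
Variable N : nat.
Hypothesis N0 : (0 < N)%N.
Local Notation Lam := (@mangoldt R).
Implicit Types f g : nat -> R.

Lemma uniform_constant (P : nat -> R -> Prop) K :
  (forall b C D, C <= D -> P b C -> P b D) ->
  (forall b, (b < K)%N -> exists2 C, 0 <= C & P b C) ->
  exists2 C, 0 <= C & forall b, (b < K)%N -> P b C.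
Proof.
move=> mono; elim: K => [|K IH] H; first by exists 0.
have [|C C0 HC] := IH; first by move=> b bK; apply: H; rewrite ltnW.
have [D D0 HD] := H K (ltnSn K).
exists (C + D) => [|b]; first exact: addr_ge0.
rewrite ltnS leq_eqVlt => /predU1P[->|bK]; first by apply: mono HD; rewrite lerDr.
by apply: mono (HC b bK); rewrite lerDl.
Qed.

Lemma per_eqmod f m n : per N f -> (m = n %[mod N])%N -> f m = f n.
Proof. by move=> pf E; rewrite -(per_modn m pf) E per_modn. Qed.

Lemma per_mull f b : per N f -> per N (fun m => f (b * m)%N).
Proof. by move=> pf m; apply: per_eqmod => //; rewrite mulnDr addnC modnMDl. Qed.

Lemma hsum_eq f g x : f =1 g -> hsum f x = hsum g x.
Proof. by move=> fg; apply: eq_bigr => m _; rewrite fg. Qed.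

Lemma hsum_modl f d x : per N f ->
  hsum (fun m => f (d * m)%N) x = hsum (fun m => f (d %% N * m)%N) x.
Proof.
by move=> pf; apply: hsum_eq => m; apply: per_eqmod => //; rewrite modnMml.
Qed.

Lemma sum_mul_coprime f n : per N f -> coprime n N ->
  \sum_(0 <= k < N) f (n * k)%N = \sum_(0 <= k < N) f k.
Proof.
move=> pf nN; rewrite !big_mkord.
pose h (k : 'I_N) : 'I_N := Ordinal (ltn_pmod (n * k) N0).
have h_inj : injective h.
  move=> k l /(congr1 val) /= E; apply: val_inj => /=.
  wlog kl : k l E / (k <= l)%N.
    by move=> W; case/orP: (leq_total k l) => [|lk]; [apply: W|apply/esym/W].
  have : (N %| n * (l - k))%N by rewrite mulnBr -eqn_mod_dvd ?leq_mul2l ?kl ?orbT // E.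
  rewrite Gauss_dvdr; last by rewrite coprime_sym.
  case: (posnP (l - k)%N) => [lk _|lk /(dvdn_leq lk)]; last by have := ltn_ord l; lia.
  by apply/eqP; rewrite eqn_leq kl -subn_eq0 lk.
rewrite [RHS](reindex_inj h_inj) /=; apply: eq_bigr => k _.
by apply: per_eqmod => //; rewrite modn_mod.
Qed.

Definition supported f := forall n, ~~ coprime n N -> f n = 0.

Lemma hsum_unsupported f d x : supported f -> ~~ coprime d N ->
  hsum (fun m => f (d * m)%N) x = 0.
Proof.
move=> sf dN; rewrite /hsum big1 // => m _; rewrite sf ?mul0r //.
by rewrite coprimeMl negb_and dN.
Qed.

(** Only d mod N matters, and for d not prime to N the sums are 0, so finitely many constants
    suffice. Uniformity in d is what [selberg_asymptotic] asks for. *)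
Lemma vanishing_uniform f : per N f -> supported f ->
  (forall b, coprime b N -> vanishing (fun m => f (b * m)%N)) ->
  exists2 C, 0 <= C &
    forall d x, `|hsum (fun m => f (d * m)%N) x| <= C / x.+1%:R.
Proof.
move=> pf sf H.
have [b C D CD P x|b _|C C0 HC] := @uniform_constant (fun b C => forall x,
   `|hsum (fun m => f (b * m)%N) x| <= C / x.+1%:R) N.
- by apply: le_trans (P x) _; rewrite ler_wpM2r // invr_ge0.
- have [/H[C C0 HC]|bN] := boolP (coprime b N); first by exists C.
  by exists 0 => // x; rewrite hsum_unsupported // normr0 mul0r.
- by exists C => // d x; rewrite hsum_modl //; apply: HC; rewrite ltn_pmod.
Qed.

Lemma hsum_tail_uniform f : per N f -> supported f -> \sum_(0 <= k < N) f k = 0 ->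
  exists2 B, 0 <= B & forall d x y, (x <= y)%N ->
    `|hsum (fun m => f (d * m)%N) y - hsum (fun m => f (d * m)%N) x| <= B / x.+1%:R.
Proof.
move=> pf sf f0.
have [b C D CD P x y xy|b _|C C0 HC] := @uniform_constant (fun b C => forall x y, (x <= y)%N ->
   `|hsum (fun m => f (b * m)%N) y - hsum (fun m => f (b * m)%N) x| <= C / x.+1%:R) N.
- by apply: le_trans (P x y xy) _; rewrite ler_wpM2r // invr_ge0.
- have [bN|bN] := boolP (coprime b N).
    by apply: (hsum_tail N0); [exact: per_mull|rewrite sum_mul_coprime].
  by exists 0 => // x y _; rewrite !hsum_unsupported // subrr normr0 mul0r.
- exists C => // d x y xy; rewrite !(@hsum_modl _ d) //.
  by apply: HC; rewrite ?ltn_pmod.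
Qed.

Lemma ln_succ_le n : (0 < n)%N -> n%:R * ln n.+1%:R <= n%:R * ln n%:R + 1 :> R.
Proof.
move=> n0; have n0R : 0 < n%:R :> R by rewrite ltr0n.
have i0 : 0 < n%:R^-1 :> R by rewrite invr_gt0.
have -> : n.+1%:R = n%:R * (1 + n%:R^-1) :> R.
  by rewrite mulrDr mulr1 divff ?gt_eqF // natr1.
rewrite lnM ?posrE ?addr_gt0 // mulrDr lerD2l mulrC -ler_pdivlMr // mul1r le_ln1Dx //.
by apply: lt_trans i0; lra.
Qed.

(* [ln n / n] is not monotone near [1], but [(ln n + 1) / n] is. *)
Lemma log_sum_bounded f : per N f -> \sum_(0 <= k < N) f k = 0 ->
  exists2 C, 0 <= C & forall x, `|\sum_(1 <= n < x.+1) f n * ln n%:R / n%:R| <= C.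
Proof.
move=> pf f0; have [B B0 HB] := per_sum_bound N0 pf f0.
have [D D0 HD] := hsum_bounded N0 pf f0.
exists (B + D) => [|x]; first exact: addr_ge0.
pose g n : R := (ln n%:R + 1) / n%:R.
have -> : \sum_(1 <= n < x.+1) f n * ln n%:R / n%:R =
    \sum_(1 <= n < x.+1) f n * g n - hsum f x.
  by rewrite /hsum -sumrB; apply: eq_bigr => n _; rewrite /g; ring.
apply: le_trans (ler_normB _ _) _; apply: lerD => //.
have -> : B = B * g 1%N by rewrite /g ln1 add0r divr1 mulr1.
apply: abel_summation => n n0; first exact: HB.
  by rewrite divr_ge0 // addr_ge0 // ln_nat_ge0.
have n0R : 0 < n%:R :> R by rewrite ltr0n.
rewrite /g ler_pdivrMr ?ltr0n // mulrAC ler_pdivlMr //.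
have := ln_succ_le n0; have := ln_nat_ge0 R n; rewrite -(natr1 n).
by set a := ln _; set b := ln _; lra.
Qed.

Lemma ln_unbounded (K : R) X : exists2 y, (X < y)%N & K < ln y%:R.
Proof.
have [n Hn] := archi_nat (expR K).
exists (maxn n X.+1); first by rewrite leq_maxr.
have n0 : (0 < n)%N by rewrite -(ltr_nat R); apply: le_lt_trans Hn; exact: expR_ge0.
apply: lt_le_trans (_ : ln n%:R <= _); last by apply: ln_le_nat; rewrite n0 leq_maxl.
by rewrite -ltr_expR lnK // posrE ltr0n.
Qed.

Section Concentration.
Variables (Z : pred nat) (C2 C3 : R).
Hypothesis C20 : 0 <= C2.
Hypothesis offZ : forall x,
  \sum_(1 <= n < x.+1 | coprime n N && ~~ Z n) Lam n / n%:R <= C2.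
Hypothesis onZ : forall x, (0 < x)%N ->
  ln x%:R - C3 <= \sum_(1 <= n < x.+1 | Z n) Lam n / n%:R.

Lemma Lam_div_ge0 n : 0 <= Lam n / n%:R.
Proof. by rewrite divr_ge0 // mangoldt_ge0. Qed.

(** Writing ln as the divisor sum of Lambda expresses the bounded sum of f(b n) ln(n)/n through the
    partial sums up to x / d for m -> f(b d m), weighted by Lambda(d)/d. For d in [Z] such a sum is
    that of m -> f(b m) and differs from its value at x by at most B d / x; hence [hsum fb x] times
    ln x is O(1). *)
Lemma concentration_vanishing f : per N f -> supported f ->
  \sum_(0 <= k < N) f k = 0 ->
  (forall n m, Z n -> f (n * m)%N = f m) ->
  forall b, coprime b N -> vanishing (fun m => f (b * m)%N).
Proof.
move=> pf sf f0 fZ b bN; set fb := fun m => f (b * m)%N.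
have pfb : per N fb by exact: per_mull.
have fb0 : \sum_(0 <= k < N) fb k = 0 by rewrite sum_mul_coprime.
have [B B0 HB] := hsum_tail_uniform pf sf f0.
have [Cl Cl0 HCl] := log_sum_bounded pfb fb0.
have bound d x : `|hsum (fun m => f (d * m)%N) x| <= B.
  by have := HB d 0%N x isT; rewrite /hsum [X in _ - X]big_geq // subr0 divr1.
(* [Cl] bounds the sum with ln n, [C2 * B] the terms off [Z], and [4 * B] the cost of replacing x /
   d by x, through Chebyshev's bound. *)
pose C5 := Cl + C2 * B + 4 * B.
have key x : (0 < x)%N -> `|hsum fb x| * (ln x%:R - C3) <= C5.
  move=> x0; have x0R : 0 < x%:R :> R by rewrite ltr0n.
  apply: le_trans (ler_wpM2l (normr_ge0 _) (onZ x0)) _.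
  have E : \sum_(1 <= n < x.+1) fb n * ln n%:R / n%:R =
     \sum_(1 <= d < x.+1) Lam d / d%:R * hsum (fun m => f (b * d * m)%N) (x %/ d).
    transitivity (\sum_(1 <= n < x.+1)
       dsum (fun d => Lam d * (f (b * d * (n %/ d))%N / (d * (n %/ d))%:R)) n).
      apply: eq_big_nat => n /andP[n0 _]; rewrite -dsum_mangoldt // /dsum.
      rewrite mulrAC big_distrr /=; apply: eq_bigr => d dn.
      by rewrite /fb -mulnA (mulnC d) divnK //; ring.
    rewrite (sum_dsum (fun d m => Lam d * (f (b * d * m)%N / (d * m)%:R))).
    apply: eq_bigr => d _; rewrite /hsum big_distrr /=; apply: eq_bigr => m _.
    by rewrite natrM invfM; ring.
  have E2 : hsum fb x * \sum_(1 <= n < x.+1 | Z n) Lam n / n%:R =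
     \sum_(1 <= n < x.+1) fb n * ln n%:R / n%:R
     - \sum_(1 <= d < x.+1 | ~~ Z d) Lam d / d%:R * hsum (fun m => f (b * d * m)%N) (x %/ d)
     + \sum_(1 <= d < x.+1 | Z d) Lam d / d%:R * (hsum fb x - hsum fb (x %/ d)).
    rewrite E [X in X - _ + _](bigID Z) /= addrK -big_split /= big_distrr /=.
    apply: eq_bigr => d Zd; rewrite -mulrDr.
    have -> : hsum (fun m => f (b * d * m)%N) (x %/ d) = hsum fb (x %/ d).
      by apply: hsum_eq => m; rewrite /fb mulnAC mulnC fZ.
    by ring.
  have <- : `|\sum_(1 <= n < x.+1 | Z n) Lam n / n%:R| = \sum_(1 <= n < x.+1 | Z n) Lam n / n%:R.
    by rewrite ger0_norm // sumr_ge0 // => n _; exact: Lam_div_ge0.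
  rewrite -normrM E2; apply: le_trans (ler_normD _ _) _; apply: lerD.
    apply: le_trans (ler_normB _ _) _; apply: lerD => //.
    apply: le_trans (ler_norm_sum _ _ _) _.
    apply: le_trans (_ : \sum_(1 <= n < x.+1 | coprime n N && ~~ Z n) Lam n / n%:R * B <= _).
      rewrite [leLHS](bigID (coprime^~ N)) /= [X in _ + X]big1 ?addr0; last first.
        move=> d /andP[_ dN]; rewrite hsum_unsupported ?mulr0 ?normr0 //.
        by rewrite coprimeMl negb_and dN orbT.
      rewrite (eq_bigl (fun d => coprime d N && ~~ Z d)); last by move=> d; rewrite andbC.
      apply: ler_sum => d _; rewrite normrM (ger0_norm (Lam_div_ge0 _)).
      by apply: ler_wpM2l; rewrite ?Lam_div_ge0.
    by rewrite -big_distrl /=; apply: ler_wpM2r.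
  apply: le_trans (ler_norm_sum _ _ _) _.
  apply: le_trans (_ : \sum_(1 <= d < x.+1) Lam d * (B / x%:R) <= _).
    rewrite [leLHS]big_mkcond /=; apply: ler_sum_nat => d /andP[d0 dx].
    have d0R : 0 < d%:R :> R by rewrite ltr0n.
    case: ifP => _; last by rewrite mulr_ge0 ?mangoldt_ge0 // divr_ge0.
    rewrite normrM (ger0_norm (Lam_div_ge0 _)) -mulrA; apply: ler_wpM2l.
      exact: mangoldt_ge0.
    rewrite mulrC ler_pdivrMr //; apply: le_trans (HB b _ _ (leq_div x d)) _.
    rewrite -mulrA; apply: ler_wpM2l => //.
    rewrite -[leLHS]mul1r ler_pdivrMr ?ltr0n // -mulrA mulrC ler_pdivlMr // mul1r.
    by rewrite -natrM ler_nat mulnC ltnW // ltn_ceil.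
  rewrite -big_distrl /= -/(psi R x) mulrA ler_pdivrMr // mulrAC.
  by apply: (ler_wpM2r B0); exact: chebyshev.
apply: (vanishing_subseq N0 pfb fb0) => eps X eps0.
have C50 : 0 <= C5 by rewrite !addr_ge0 ?mulr_ge0.
have [y Xy Hy] := ln_unbounded (C3 + C5 / eps + 1) X.
exists y; first exact: ltnW.
have y0 : (0 < y)%N by apply: leq_ltn_trans Xy.
have q0 : 0 <= C5 / eps by rewrite divr_ge0 // ltW.
have L0 : 0 < ln y%:R - C3 by lra.
rewrite -(ler_pM2r L0); apply: le_trans (key y y0) _.
by rewrite mulrC -ler_pdivrMr //; lra.
Qed.

(** Selberg's estimate makes the sum of f(n) Lambda(n)/n equal to - f(1) ln x + O(1). On [Z] however
    f(n) = f(1), so concentration makes it f(1) ln x + O(1) from below, which excludes f(1) > 0. *)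
Lemma concentration_nonpos f : per N f -> supported f ->
  \sum_(0 <= k < N) f k = 0 ->
  (forall n m, Z n -> f (n * m)%N = f m) -> f 1%N <= 0.
Proof.
move=> pf sf f0 fZ.
have [C C0 HC] := vanishing_uniform pf sf (concentration_vanishing pf sf f0 fZ).
have sel := selberg_asymptotic C0 (fun d x _ => HC d x).
pose F := \sum_(0 <= k < N) `|f k|.
have fF n : `|f n| <= F.
  have nN : (n %% N < N)%N by rewrite ltn_pmod.
  rewrite -(per_modn n pf) /F big_mkord (bigD1 (Ordinal nN)) //= lerDl.
  by rewrite sumr_ge0.
have F0 : 0 <= F := le_trans (normr_ge0 _) (fF 0%N).
rewrite leNgt; apply/negP => f1.
have [x /(leq_ltn_trans (leq0n _)) x0 Hx] := ln_unbounded ((C + F * C2 + f 1%N * C3) / f 1%N) 1.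
have {}Hx : C + F * C2 + f 1%N * C3 < f 1%N * ln x%:R.
  by move: Hx; rewrite ltr_pdivrMr // [ltRHS]mulrC.
have := sel x x0.
have -> : \sum_(1 <= n < x.+1) f n * Lam n / n%:R =
   f 1%N * (\sum_(1 <= n < x.+1 | Z n) Lam n / n%:R) +
   \sum_(1 <= n < x.+1 | coprime n N && ~~ Z n) f n * (Lam n / n%:R).
  rewrite (bigID Z) /= big_distrr /=; congr (_ + _).
    by apply: eq_bigr => n Zn; rewrite -{1}[n]muln1 fZ // mulrA.
  rewrite (bigID (coprime^~ N)) /= [X in _ + X]big1 ?addr0; last first.
    by move=> n /andP[_ nN]; rewrite sf // !mul0r.
  by apply: eq_big => [n|n _]; rewrite ?mulrA // andbC.
set S := \sum_(_ <= _ < _ | _ && _) _ => H.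
have SF : `|S| <= F * C2.
  apply: le_trans (ler_norm_sum _ _ _) _.
  apply: le_trans (ler_wpM2l F0 (offZ x)); rewrite big_distrr /=.
  apply: ler_sum => n _; rewrite normrM (ger0_norm (Lam_div_ge0 _)).
  by apply: ler_wpM2r; rewrite ?Lam_div_ge0.
have := ler_wpM2l (ltW f1) (onZ x0); rewrite mulrBr.
move: H SF; rewrite !ler_norml => /andP[_ H1] /andP[H2 _] H3.
have l0 : 0 <= f 1%N * ln x%:R by rewrite mulr_ge0 ?ln_nat_ge0 // ltW.
by lra.
Qed.

End Concentration.

End Nonvanishing.

(** * The autocorrelation of a relation and the nonvanishing theorem *)

Section NonvanishingTheorem.
Variables (R : realType) (N : nat) (c : nat -> R).
Hypothesis N0 : (0 < N)%N.
Hypothesis pc : per N c.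
Hypothesis sc : supported N c.
Hypothesis c0 : \sum_(0 <= k < N) c k = 0.
Hypothesis vc : forall b, coprime b N -> vanishing (fun m => c (b * m)%N).
Hypothesis cS : 0 < \sum_(0 <= k < N) c k ^+ 2.
Local Notation Lam := (@mangoldt R).

Let S : R := \sum_(0 <= k < N) c k ^+ 2.

(* The normalised autocorrelation of [c] is positive definite, so it plays the role
   of a positive combination of the characters occurring in [c]. *)
Definition autocorr n : R := (\sum_(0 <= k < N) c k * c (n * k)%N) / S.
Local Notation e := autocorr.

Lemma autocorr1 : e 1%N = 1.
Proof.
rewrite /e (eq_bigr (fun k => c k ^+ 2)) ?divff ?gt_eqF // => k _.
by rewrite mul1n expr2.
Qed.

Lemma autocorr_per : per N e.
Proof.
move=> n; rewrite /e; congr (_ / _); apply: eq_bigr => k _; congr (_ * _).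
by apply: (per_eqmod pc); rewrite mulnDl mulnC (mulnC N) addnC modnMDl mulnC.
Qed.

Lemma autocorr_supported : supported N e.
Proof.
move=> n nN; rewrite /e big1 ?mul0r // => k _.
by rewrite (sc (n := (n * k)%N)) ?mulr0 // coprimeMl negb_and nN.
Qed.

Lemma autocorr_sum : \sum_(0 <= n < N) e n = 0.
Proof.
rewrite /e -big_distrl /= exchange_big /= big1 ?mul0r // => k _.
rewrite -big_distrr /=; have [kN|kN] := boolP (coprime k N); last by rewrite sc ?mul0r.
rewrite (eq_bigr (fun n => c (k * n)%N)); last by move=> n _; rewrite mulnC.
by rewrite (sum_mul_coprime N0 pc kN) c0 mulr0.
Qed.

(** The function [c] and its dilate by a unit n both have square norm S, so expanding the square
    yields Cauchy-Schwarz with its equality case: s e(n) <= 1, and s e(n) = 1 forces c(n k) = s c(k)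
    for all k. *)
Lemma autocorr_sqdist n s : coprime n N -> s ^+ 2 = 1 ->
  \sum_(0 <= k < N) (c (n * k)%N - s * c k) ^+ 2 = 2 * S * (1 - s * e n).
Proof.
move=> nN s2.
have Sn : \sum_(0 <= k < N) c (n * k)%N ^+ 2 = S.
  apply: (@sum_mul_coprime _ _ N0 (fun m => c m ^+ 2)) => // m.
  by rewrite pc.
have eS : e n * S = \sum_(0 <= k < N) c k * c (n * k)%N by rewrite /e mulfVK // gt_eqF.
have -> : 2 * S * (1 - s * e n) = S - 2 * s * (e n * S) + s ^+ 2 * S by rewrite s2; ring.
rewrite eS -{1}Sn /S !big_distrr /= -sumrB -big_split /=.
by apply: eq_bigr => k _; ring.
Qed.

Lemma autocorr_bound n s : coprime n N -> s ^+ 2 = 1 -> s * e n <= 1.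
Proof.
move=> nN s2; have := autocorr_sqdist nN s2; rewrite -subr_ge0 => E.
rewrite -(pmulr_rge0 _ (_ : 0 < 2 * S)) ?mulr_gt0 // -E.
by apply: sumr_ge0 => k _; exact: sqr_ge0.
Qed.

Lemma autocorr_extremal n s : coprime n N -> s ^+ 2 = 1 -> s * e n = 1 ->
  forall k, c (n * k)%N = s * c k.
Proof.
move=> nN s2 es k; have := autocorr_sqdist nN s2; rewrite es subrr mulr0 big_mkord.
have ge0 (i : 'I_N) : true -> 0 <= (c (n * i)%N - s * c i) ^+ 2 by rewrite sqr_ge0.
move/(psumr_eq0P ge0) => H.
have := H (Ordinal (ltn_pmod k N0)) isT; move/eqP; rewrite sqrf_eq0 subr_eq0 => /eqP /=.
rewrite (per_modn k pc) => <-; apply: (per_eqmod pc); by rewrite modnMmr.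
Qed.

Lemma autocorr_norm n : `|e n| <= 1.
Proof.
have [nN|nN] := boolP (coprime n N); last by rewrite autocorr_supported ?normr0.
have := autocorr_bound nN (s := 1); have := autocorr_bound nN (s := -1).
rewrite sqrrN expr1n mulN1r mul1r ler_norml lerNl => /(_ erefl) -> /(_ erefl) -> //.
Qed.

Lemma autocorr_neg n : e n = -1 -> coprime n N.
Proof.
by move=> en; apply: contraT => nN; move/eqP: en; rewrite autocorr_supported // eq_sym oppr_eq0 oner_eq0.
Qed.

(** By the equality case of Cauchy-Schwarz, multiplication by n acts on [c] as the sign e(n), which
    comes out of the correlation. *)
Lemma autocorr_shift n m : e n ^+ 2 = 1 -> coprime n N -> e (n * m)%N = e n * e m.
Proof.
move=> en nN; have H := autocorr_extremal nN en (en : e n * e n = 1).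
rewrite {1 3}/e mulrA big_distrr /=; congr (_ / _); apply: eq_bigr => k _.
by rewrite -mulnA H; ring.
Qed.

Lemma autocorr_hsum : exists2 C, 0 <= C &
  forall d x, `|hsum (fun m => e (d * m)%N) x| <= C / x.+1%:R.
Proof.
have [C C0 HC] := vanishing_uniform N0 pc sc vc.
exists ((\sum_(0 <= k < N) `|c k|) / S * C).
  by apply: mulr_ge0 => //; apply: divr_ge0; [exact: sumr_ge0|exact: ltW].
move=> d x.
have -> : hsum (fun m => e (d * m)%N) x =
    (\sum_(0 <= k < N) c k * hsum (fun m => c (d * k * m)%N) x) / S.
  rewrite /hsum; under [in RHS]eq_bigr do rewrite big_distrr.
  rewrite exchange_big /= big_distrl /=; apply: eq_bigr => m _.
  rewrite /e mulrAC big_distrl /=; congr (_ / _); apply: eq_bigr => k _.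
  by rewrite mulnAC mulrA.
rewrite normrM normfV (gtr0_norm cS) ler_pdivrMr //.
have -> : (\sum_(0 <= k < N) `|c k|) / S * C / x.+1%:R * S =
    (\sum_(0 <= k < N) `|c k|) * (C / x.+1%:R).
  have S0 : S != 0 by rewrite gt_eqF.
  by rewrite -(mulrA (_ / S) C) (mulrAC (_ / S)) mulfVK.
apply: le_trans (ler_norm_sum _ _ _) _; rewrite big_distrl /=.
by apply: ler_sum => k _; rewrite normrM; apply: ler_wpM2l.
Qed.

Lemma autocorr_not_real : (forall n, coprime n N -> e n ^+ 2 = 1) -> False.
Proof.
move=> e2; have [C C0 HC] := autocorr_hsum.
apply: (real_character_nonvanishing N0 autocorr_per autocorr_sum autocorr1).
- move=> m n; have [mN|mN] := boolP (coprime m N); first exact: autocorr_shift (e2 _ mN) _.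
  by rewrite (autocorr_supported mN) mul0r autocorr_supported // coprimeMl negb_and mN.
- move=> n; have [nN|nN] := boolP (coprime n N); last by constructor 1; apply: autocorr_supported.
  by have /eqP := e2 n nN; rewrite sqrf_eq1 => /orP[/eqP|/eqP]; [constructor 2|constructor 3].
- by exists C => // x; have := HC 1%N x; under hsum_eq do rewrite mul1n.
Qed.

(** Selberg's estimate for [e] added to the Mertens bound keeps the sum of (1 + e(n)) Lambda(n)/n
    over units below 4 + C. Its terms are nonnegative, and 1 + e(n), taking finitely many values, is
    bounded below where e(n) <> -1. Conversely - e <= 1 makes the whole mass on units at least ln x
    - C. *)
Lemma autocorr_concentration : exists C2 C3 : R, [/\ 0 <= C2,
  forall x, \sum_(1 <= n < x.+1 | coprime n N && (e n != -1)) Lam n / n%:R <= C2 &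
  forall x, (0 < x)%N ->
    ln x%:R - C3 <= \sum_(1 <= n < x.+1 | e n == -1) Lam n / n%:R].
Proof.
have [C C0 HC] := autocorr_hsum.
have sel := selberg_asymptotic C0 (fun d x _ => HC d x).
pose W x := \sum_(1 <= n < x.+1 | coprime n N) Lam n / n%:R.
have selW x : (0 < x)%N ->
   `|\sum_(1 <= n < x.+1 | coprime n N) e n * (Lam n / n%:R) + ln x%:R| <= C.
  move=> x0; have := sel x x0; rewrite autocorr1 mul1r.
  rewrite (bigID (coprime^~ N)) /= [X in _ + X + _]big1 ?addr0.
    by under eq_bigr do rewrite -mulrA.
  by move=> n nN; rewrite autocorr_supported // !mul0r.
have WM x : (0 < x)%N -> W x <= ln x%:R + 4.
  move=> x0; apply: le_trans (mertens_upper R x0); rewrite [leRHS](bigID (coprime^~ N)) /=.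
  by rewrite lerDl sumr_ge0 // => n _; exact: Lam_div_ge0.
(* Residues with e(k) = -1 add nothing, the inverse of 0 being 0, and D bounds 1 / (1 + e(k)) at all
   others. *)
pose D := \sum_(0 <= k < N) `|(1 + e k)^-1|.
have D0 : 0 <= D by exact: sumr_ge0.
have e1D n : e n != -1 -> 1 <= D * (1 + e n).
  move=> en; have en0 : 0 < 1 + e n.
    have := autocorr_norm n; rewrite ler_norml => /andP[H _].
    by rewrite lt_neqAle eq_sym addrC addr_eq0 en /=; lra.
  rewrite -ler_pdivrMr // mul1r; apply: le_trans (ler_norm _) _.
  rewrite -(per_modn n autocorr_per) /D big_mkord (bigD1 (Ordinal (ltn_pmod n N0))) //= lerDl.
  exact: sumr_ge0.
pose C2 := D * (4 + C).
have C20 : 0 <= C2 by rewrite mulr_ge0 // addr_ge0.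
have off x : \sum_(1 <= n < x.+1 | coprime n N && (e n != -1)) Lam n / n%:R <= C2.
  case: x => [|x]; first by rewrite big_geq.
  apply: le_trans (_ : \sum_(1 <= n < x.+2 | coprime n N) D * (1 + e n) * (Lam n / n%:R) <= _).
    rewrite big_mkcondr /=; apply: ler_sum => n nN.
    case: ifP => en; first by rewrite -[leLHS]mul1r; apply: ler_wpM2r; rewrite ?Lam_div_ge0 ?e1D.
    by rewrite -mulrA mulr_ge0 // mulr_ge0 ?Lam_div_ge0 //; have := autocorr_norm n; rewrite ler_norml => /andP[H _]; lra.
  under eq_bigr do rewrite -mulrA.
  rewrite -big_distrr /=; apply: ler_wpM2l => //.
  under eq_bigr do rewrite mulrDl mul1r.
  rewrite big_split /=; have := WM _ (ltn0Sn x); have := selW _ (ltn0Sn x).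
  by rewrite ler_norml /W => /andP[_ H1] H2; lra.
exists C2, (C + C2); split=> // x x0.
have := selW x x0; rewrite ler_norml => /andP[_ H].
have HW : ln x%:R - C <= W x.
  have : - \sum_(1 <= n < x.+1 | coprime n N) e n * (Lam n / n%:R) <= W x.
    rewrite -sumrN; apply: ler_sum => n _; rewrite -mulNr -[leRHS]mul1r.
    apply: ler_wpM2r; first exact: Lam_div_ge0.
    by have := autocorr_norm n; rewrite ler_norml => /andP[h _]; lra.
  lra.
have WE : W x = \sum_(1 <= n < x.+1 | e n == -1) Lam n / n%:R +
   \sum_(1 <= n < x.+1 | coprime n N && (e n != -1)) Lam n / n%:R.
  rewrite /W (bigID (fun n => e n == -1)) /=; congr (_ + _); apply: eq_bigl => n.
  by apply: andb_idl => /eqP; exact: autocorr_neg.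
by have := off x; move: HW; rewrite WE; lra.
Qed.

End NonvanishingTheorem.

Theorem nonvanishing (R : realType) (N : nat) (c : nat -> R) : (0 < N)%N ->
  per N c -> supported N c -> \sum_(0 <= k < N) c k = 0 ->
  (forall b, coprime b N -> vanishing (fun m => c (b * m)%N)) ->
  forall n, c n = 0.
Proof.
move=> N0 pc sc c0 vc n; apply/eqP; apply: contraT => cn.
have cS : 0 < \sum_(0 <= k < N) c k ^+ 2.
  rewrite big_mkord (bigD1 (Ordinal (ltn_pmod n N0))) //= (per_modn n pc).
  by rewrite ltr_pwDl ?sumr_ge0 // ?exprn_even_gt0 // => k _; exact: sqr_ge0.
pose e := autocorr N c.
have [/forallP H|] := boolP [forall k : 'I_N, coprime k N ==> (e k ^+ 2 == 1)].
  case: (autocorr_not_real N0 pc sc c0 vc cS) => m mN.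
  have := H (Ordinal (ltn_pmod m N0)); rewrite coprime_modl mN /= => /eqP.
  by rewrite /e (per_modn m (autocorr_per pc)).
rewrite negb_forall => /existsP[k0]; rewrite negb_imply => /andP[k0N ek0].
have [C2 [C3 [C20 off on]]] := autocorr_concentration N0 pc sc vc cS.
(* [f] is e^2 minus its mean over the units, scaled by their number F. At 1 it is F - T, positive
   because e^2 <= 1 on units, strictly at [k0]. *)
pose F : R := \sum_(0 <= k < N) (coprime k N)%:R.
pose T : R := \sum_(0 <= k < N) e k ^+ 2.
pose f m : R := F * e m ^+ 2 - T * (coprime m N)%:R.
have pe := autocorr_per pc : per N e.
have se := autocorr_supported sc : supported N e.
have : f 1%N <= 0.
  apply: (concentration_nonpos N0 (Z := fun n => e n == -1) (f := f) C20 off on).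
  - by move=> m; rewrite /f pe -[coprime (m + N) N]coprime_modl modnDr coprime_modl.
  - by move=> m mN; rewrite /f se // (negbTE mN) expr0n /= !mulr0 subrr.
  - by rewrite /f sumrB -!big_distrr /= -/F -/T mulrC subrr.
  - move=> m l /eqP em; have mN := autocorr_neg sc em.
    rewrite /f coprimeMl mN /= /e (autocorr_shift N0 pc cS _ _ mN) -/e ?em ?sqrrN ?expr1n //.
    by rewrite exprMn sqrrN expr1n mul1r.
rewrite /f /e autocorr1 // coprime1n expr1n !mulr1 subr_le0 leNgt => /negP[].
rewrite -subr_gt0 /F /T -sumrB big_mkord (bigD1 k0) //=.
have le1 m : e m ^+ 2 <= (coprime m N)%:R.
  have [mN|mN] := boolP (coprime m N); last by rewrite se // expr0n.
  by rewrite -real_normK ?num_real // exprn_ile1 // autocorr_norm.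
apply: ltr_pwDl; last by apply: sumr_ge0 => k _; rewrite subr_ge0.
by rewrite k0N subr_gt0 lt_neqAle ek0 /=; have := le1 k0; rewrite k0N.
Qed.

(** * Partial fractions of the cotangent *)

Section CotangentPartialFractions.
Variable R : realType.
Implicit Types x y z : R.

Definition cot x : R := cos x / sin x.

Lemma is_derive_nondecreasing (f df : R -> R) (a b : R) : a <= b ->
  (forall z, a <= z <= b -> is_derive z 1 f (df z)) ->
  (forall z, a <= z <= b -> 0 <= df z) -> f a <= f b.
Proof.
rewrite le_eqVlt => /predU1P[-> //|ab] dfP df0; rewrite -subr_ge0.
have dfP' z : z \in `]a, b[ -> is_derive z 1 f (df z).
  by rewrite in_itv /= => /andP[az zb]; apply: dfP; rewrite !ltW.
have cf : ({within `[a, b], continuous f})%classic.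
  apply: derivable_within_continuous => z; rewrite in_itv /= => zab.
  by have := dfP z zab => ?; exact: ex_derive.
have [c] := MVT ab dfP' cf; rewrite in_itv /= => /andP[ac cb] ->.
by rewrite mulr_ge0 ?subr_ge0 ?df0 // !ltW.
Qed.

Lemma sin_le y : 0 <= y -> sin y <= y.
Proof.
move=> y0; have := @is_derive_nondecreasing (fun z => z - sin z) (fun z => 1 - cos z) 0 y y0.
rewrite sin0 subrr subr_ge0; apply=> z _; last by rewrite subr_ge0 cos_le1.
Qed.

Lemma mul_cos_le_sin y : 0 <= y <= pi -> y * cos y <= sin y.
Proof.
case/andP=> y0 ypi.
have := @is_derive_nondecreasing (fun z => sin z - z * cos z) (fun z => z * sin z) 0 y y0.
rewrite sin0 mul0r subrr subr_ge0; apply=> z /andP[z0 zy].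
  apply: trigger_derive; rewrite /GRing.scale /=; ring.
by rewrite mulr_ge0 // sin_ge0_pi // z0 (le_trans zy).
Qed.

(** The error of replacing cot y by its polar part at 0. On (0, pi) it is nonnegative, and
    nondecreasing because its derivative is 1/sin^2 y - 1/y^2. *)
Definition cot_defect y : R := y^-1 - cot y.

Lemma cot_defect_ge0 y : 0 < y < pi -> 0 <= cot_defect y.
Proof.
move=> /[dup] /sin_gt0_pi s0 /andP[y0 ypi].
rewrite subr_ge0 ler_pdivrMr // mulrC ler_pdivlMr // mulrC.
by rewrite mul_cos_le_sin // !ltW.
Qed.

Lemma cot_defect_le x y : 0 < x -> x <= y -> y < pi -> cot_defect x <= cot_defect y.
Proof.
move=> x0 xy ypi.
have H z : x <= z <= y -> (0 < z) * (0 < sin z).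
  move=> /andP[xz zy]; have z0 := lt_le_trans x0 xz; split=> //.
  by rewrite sin_gt0_pi // z0 (le_lt_trans zy).
apply: (@is_derive_nondecreasing cot_defect (fun z => (sin z) ^- 2 - z ^- 2)) => // z /H[z0 s0].
  have zn : z != 0 by rewrite gt_eqF.
  have sn : sin z != 0 by rewrite gt_eqF.
  have dV := @is_deriveV R id z 1 1 zn (is_derive_id z 1).
  rewrite /cot_defect /cot; apply: trigger_derive.
  have := cos2Dsin2 z; rewrite /GRing.scale /= => E.
  rewrite [RHS](_ : _ = (cos z ^+ 2 + sin z ^+ 2) * (sin z) ^- 2 - z ^- 2); last first.
    by rewrite E mul1r.
  by field; rewrite zn sn.
rewrite subr_ge0 lef_pV2 ?posrE ?exprn_gt0 // ler_sqr ?nnegrE; last 2 first.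
- exact: ltW.
- exact: ltW.
by apply: sin_le; exact: ltW.
Qed.

(** The identity cot x = (cot(x/2) - tan(x/2)) / 2, with the tangent written as the cotangent of the
    complementary angle so that both arguments stay in (0, pi) and the step iterates. *)
Lemma cot_halve x : 0 < x < pi -> cot x = (cot (x / 2) - cot ((pi - x) / 2)) / 2.
Proof.
move=> /andP[x0 xpi].
have s0 : 0 < sin (x / 2) by apply: sin_gt0_pihalf; lra.
have c0 : 0 < cos (x / 2) by apply: cos_gt0_pihalf; have := pi_gt0 R; lra.
have -> : (pi - x) / 2 = pi / 2 - x / 2 by ring.
have {1}-> : x = (x / 2) *+ 2 by rewrite -mulr_natr; field.
rewrite /cot cosB sinB cos_pihalf sin_pihalf sin_mulr2n cos_mulr2n !mul0r !mul1r add0r subr0.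
have := cos2Dsin2 (x / 2); move: (sin _) (cos _) s0 c0 => s c s0 c0 E.
have -> : c ^+ 2 *+ 2 - 1 = c ^+ 2 - s ^+ 2 by rewrite -E; ring.
by field; rewrite !gt_eqF.
Qed.

Lemma cot_dyadic m x : 0 < x < pi -> cot x = (2 ^ m.+1)%:R^-1 *
  \sum_(0 <= k < 2 ^ m) (cot ((x + k%:R * pi) / (2 ^ m.+1)%:R)
     - cot ((pi - x + k%:R * pi) / (2 ^ m.+1)%:R)).
Proof.
move=> xpi; have pi0 := pi_gt0 R.
elim: m => [|m IH]; first by rewrite big_nat1 mul0r !addr0 cot_halve // mulrC.
rewrite {}IH; set h := (2 ^ m)%N; have -> : (2 ^ m.+2 = 4 * h)%N by rewrite !expnS mulnA.
have -> : (2 ^ m.+1 = 2 * h)%N by rewrite !expnS.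
have h0 : (0 < h)%N by rewrite expn_gt0.
have h0R : 0 < h%:R :> R by rewrite ltr0n.
pose G k := cot ((x + k%:R * pi) / (4 * h)%:R) - cot ((pi - x + k%:R * pi) / (4 * h)%:R).
(* Halving the angle of index k yields at the next level the index k and, from the subtracted
   cotangent, the reflected index 2 h - 1 - k. *)
have half k : (k < h)%N -> cot ((x + k%:R * pi) / (2 * h)%:R)
     - cot ((pi - x + k%:R * pi) / (2 * h)%:R) = (G k + G ((2 * h).-1 - k)%N) / 2.
  move=> kh; have kh1 : k%:R + 1 <= h%:R :> R by rewrite natr1 ler_nat.
  have E : ((2 * h).-1 - k)%:R = 2 * h%:R - 1 - k%:R :> R.
    by rewrite natrB ?predn_sub -?subn1 ?natrB ?natrM //; lia.
  have inr y : 0 < y < pi -> 0 < (y + k%:R * pi) / (2 * h)%:R < pi.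
    case/andP=> y0 ypi; rewrite natrM divr_gt0 ?mulr_gt0 //; last first.
      by rewrite ltr_wpDr // mulr_ge0 // ltW.
    rewrite ltr_pdivrMr ?mulr_gt0 //=.
    have : k%:R * pi + pi <= h%:R * pi :> R by rewrite -[X in _ + X <= _]mul1r -mulrDl ler_pM2r.
    have : 0 < h%:R * pi :> R by rewrite mulr_gt0.
    by rewrite (mulrC pi) -mulrA; lra.
  have cmp y : 0 < y < pi -> cot ((y + k%:R * pi) / (2 * h)%:R) =
      (cot ((y + k%:R * pi) / (4 * h)%:R)
       - cot ((pi - y + ((2 * h).-1 - k)%:R * pi) / (4 * h)%:R)) / 2.
    move=> /inr/cot_halve->; congr ((cot _ - cot _) / 2).
      by rewrite !natrM; field; rewrite gt_eqF.
    by rewrite E !natrM; field; rewrite gt_eqF.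
  rewrite !cmp // /G; last by lra.
  have -> : pi - (pi - x) = x by ring.
  by ring.
have -> : \sum_(0 <= k < 2 * h) G k = \sum_(0 <= k < h) (G k + G ((2 * h).-1 - k)%N).
  rewrite [RHS]big_split /= [LHS](@big_cat_nat _ _ _ h) //=; last by rewrite mul2n -addnn leq_addr.
  congr (_ + _); rewrite big_nat_rev /= -{1}[h]add0n big_addn.
  have -> : (2 * h - h = h)%N by lia.
  by apply: eq_bigr => k _; congr G; lia.
rewrite (eq_big_nat _ _ (F2 := fun k => (G k + G ((2 * h).-1 - k)%N) / 2)); last first.
  by move=> k /andP[_ kh]; exact: half.
rewrite -big_distrl /= !natrM; move: (\sum_(_ <= _ < _) _) => S.
by field; rewrite gt_eqF.
Qed.

(** As pi - x + k pi = - (x - (k+1) pi), these are the polar terms 1/(x + k pi) + 1/(x - (k+1) pi)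
    of cot x, taken in pairs. *)
Definition cot_partial x n : R :=
  \sum_(0 <= k < n) ((x + k%:R * pi)^-1 - (pi - x + k%:R * pi)^-1).

(* The error is [1/M] times an alternating sum of values of the monotone function
   [cot_defect], hence telescopes. *)
Lemma cot_partial_error m x : 0 < x < pi -> x <= pi / 2 ->
  `|cot x - cot_partial x (2 ^ m)| <= 2 / (2 ^ m)%:R.
Proof.
move=> xpi xhalf; have pi0 := pi_gt0 R; case/andP: (xpi) => x0 xltpi.
set h := (2 ^ m)%N; have h0 : (0 < h)%N by rewrite expn_gt0.
have h0R : 0 < h%:R :> R by rewrite ltr0n.
have ME : (2 ^ m.+1)%:R = 2 * h%:R :> R by rewrite expnS natrM.
pose a k := (x + k%:R * pi) / (2 * h%:R); pose b k := (pi - x + k%:R * pi) / (2 * h%:R).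
have D0 : 0 < 2 * h%:R :> R by rewrite mulr_gt0.
have E : cot x - cot_partial x h =
    (2 * h%:R)^-1 * \sum_(0 <= k < h) (cot_defect (b k) - cot_defect (a k)).
  rewrite (cot_dyadic m xpi) ME -/h /cot_partial !big_distrr /= -sumrB.
  apply: eq_big_nat => k _; rewrite /cot_defect -/(a k) -/(b k).
  have -> : (a k)^-1 = 2 * h%:R * (x + k%:R * pi)^-1 by rewrite invf_div.
  have -> : (b k)^-1 = 2 * h%:R * (pi - x + k%:R * pi)^-1 by rewrite invf_div.
  move: ((x + _)^-1) ((pi - x + _)^-1) (cot (a k)) (cot (b k)) => P Q ca cb.
  by field; rewrite gt_eqF.
have ab k : a k <= b k by rewrite ler_pM2r ?invr_gt0 // lerD2r; lra.
have ba k : b k <= a k.+1.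
  rewrite ler_pM2r ?invr_gt0 // -natr1 mulrDl mul1r; lra.
have a0 k : 0 < a k by rewrite divr_gt0 // ltr_wpDr // mulr_ge0 // ltW.
have bpi k : (k < h)%N -> b k < pi.
  move=> kh; rewrite ltr_pdivrMr //.
  have : k%:R * pi + pi <= h%:R * pi :> R by rewrite -[X in _ + X <= _]mul1r -mulrDl ler_pM2r // natr1 ler_nat.
  have : 0 < h%:R * pi :> R by rewrite mulr_gt0.
  by rewrite (mulrC pi) -mulrA; lra.
have mono n : (n < h)%N ->
   0 <= \sum_(0 <= k < n.+1) (cot_defect (b k) - cot_defect (a k)) <= cot_defect (b n).
  elim: n => [|n IH] nh.
    rewrite big_nat1 subr_ge0 cot_defect_le ?bpi //= gerBl cot_defect_ge0 // a0 /=.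
    exact: le_lt_trans (ab _) (bpi _ nh).
  have /andP[H1 H2] := IH (ltnW nh).
  have G1 : cot_defect (b n) <= cot_defect (a n.+1).
    apply: cot_defect_le; rewrite ?ba //; first exact: lt_le_trans (a0 n) (ab n).
    exact: le_lt_trans (ab _) (bpi _ nh).
  have G2 : cot_defect (a n.+1) <= cot_defect (b n.+1) by rewrite cot_defect_le ?bpi.
  rewrite big_nat_recr //=; move: (\sum_(_ <= _ < _) _) H1 H2 => S H1 H2.
  by apply/andP; split; lra.
have hE : h = h.-1.+1 by rewrite prednK.
have := mono h.-1; rewrite -hE => /(_ (leqnn _)).
move: E; move: (\sum_(_ <= _ < _) _) => S -> /andP[S0 SB].
have bl0 : 0 < b h.-1 := lt_le_trans (a0 _) (ab _).
have bE : b h.-1 = pi / 2 - x / (2 * h%:R).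
  by rewrite /b -subn1 natrB //; field; rewrite gt_eqF.
(* The hypothesis x <= pi / 2 keeps the last point between pi / 4 and pi / 2, so the cotangent there
   is nonnegative and [cot_defect] is at most its inverse, hence at most 2. *)
have b4 : 2^-1 <= b h.-1.
  have : x / (2 * h%:R) <= pi / 4.
    rewrite ler_pdivrMr //; have : 1 <= h%:R :> R by rewrite ler1n.
    by rewrite -(ler_pM2l pi0); lra.
  by rewrite bE; have := pi_ge2 R; lra.
have S2 : S <= 2.
  apply: le_trans SB _; apply: le_trans (_ : (b h.-1)^-1 <= _); last first.
    by rewrite -[leRHS]invrK lef_pV2 ?posrE ?invr_gt0.
  rewrite gerBl divr_ge0 //; last first.
    by rewrite sin_ge0_pi // !ltW // bpi // -hE.
  apply: cos_ge0_pihalf; have : 0 <= x / (2 * h%:R) by rewrite divr_ge0 // ltW.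
  by move: bl0; rewrite bE; lra.
rewrite normrM (ger0_norm S0) gtr0_norm ?invr_gt0 // mulrC invfM mulrA.
apply: ler_wpM2r; first by rewrite invr_ge0 ltW.
lra.
Qed.

End CotangentPartialFractions.

(** * From cotangent relations to the series of c(n)/n *)

Section CotangentVanishing.
Variables (R : realType) (N : nat).
Hypothesis N1 : (1 < N)%N.

Lemma cot_pi_sub (x : R) : cot (pi - x) = - cot x.
Proof. by rewrite /cot cosB sinB cospi sinpi !mul0r !mulN1r addr0 sub0r opprK mulNr. Qed.

Lemma cot_partial_pi_sub (x : R) n : cot_partial (pi - x) n = - cot_partial x n.
Proof.
rewrite /cot_partial -sumrN; apply: eq_bigr => k _.
have -> : pi - (pi - x) = x by ring.
by rewrite opprB.
Qed.

Lemma cot_partial_error_sym m (x : R) : 0 < x < pi ->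
  `|cot x - cot_partial x (2 ^ m)| <= 2 / (2 ^ m)%:R.
Proof.
move=> xpi; have [xh|xh] := leP x (pi / 2); first exact: cot_partial_error.
have -> : x = pi - (pi - x) by ring.
rewrite cot_pi_sub cot_partial_pi_sub opprK addrC distrC.
by apply: cot_partial_error; lra.
Qed.

Definition odd_mod (c : nat -> R) := forall k, (k <= N)%N -> c (N - k)%N = - c k.

Lemma sum_reflect (F : nat -> R) :
  \sum_(1 <= j < N) F (N - j)%N = \sum_(1 <= j < N) F j.
Proof.
rewrite [RHS]big_nat_rev /=; apply: eq_bigr => j _; congr F; lia.
Qed.

Lemma odd_mod_sum c : odd_mod c -> c 0%N = 0 -> \sum_(0 <= k < N) c k = 0.
Proof.
move=> oc c0; rewrite big_ltn ?(ltnW N1) // c0 add0r.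
have : \sum_(1 <= k < N) c k = - \sum_(1 <= k < N) c k; last by lra.
rewrite -{1}sum_reflect -sumrN; apply: eq_big_nat => k /andP[_ kN].
by rewrite oc // ltnW.
Qed.

(** Summing over h full periods and pairing j with N - j turns twice the partial sum into the
    combination of the c(j) with (pi/N) [cot_partial] at j pi / N, so the series of c(n)/n is
    pi/(2N) times the cotangent sum. Only h = 2^m is controlled; [vanishing_subseq] supplies the
    rest. *)
Lemma cot_vanishing c : per N c -> odd_mod c -> c 0%N = 0 ->
  \sum_(0 <= k < N) c k * cot (k%:R * pi / N%:R) = 0 -> vanishing c.
Proof.
move=> pc oc c0 cc; have N0 := ltnW N1; have pi0 := pi_gt0 R.
have N0R : 0 < N%:R :> R by rewrite ltr0n.
have perc q j : c (j + q * N)%N = c j by apply: (per_eqmod pc); rewrite addnC modnMDl.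
have group h : hsum c (h * N) =
    \sum_(0 <= j < N) c j * \sum_(0 <= q < h) (j + q * N)%:R^-1.
  transitivity (\sum_(0 <= n < h * N) c n / n%:R).
    have cN : c (h * N)%N = 0 by rewrite -[(h * N)%N]add0n perc.
    case: (posnP (h * N)) cN => [-> _|hN cN]; first by rewrite /hsum !big_geq.
    by rewrite /hsum big_nat_recr //= cN mul0r addr0 [RHS]big_ltn // c0 mul0r add0r.
  elim: h => [|h IH].
    by rewrite big_geq // big1_seq // => j _; rewrite big_geq ?mulr0.
  rewrite mulSn addnC (@big_cat_nat _ _ _ (h * N)) ?leq_addr //= IH.
  rewrite -{1}[(h * N)%N]add0n big_addn addKn -big_split /=.
  by apply: eq_bigr => j _; rewrite big_nat_recr //= mulrDr perc.
pose A h j : R := \sum_(0 <= q < h) ((j + q * N)%:R^-1 - (N - j + q * N)%:R^-1).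
have twice h : 2 * hsum c (h * N) = \sum_(1 <= j < N) c j * A h j.
  rewrite group big_ltn // c0 mul0r add0r mulr_natl mulr2n -{2}sum_reflect -big_split /=.
  apply: eq_big_nat => j /andP[_ jN].
  by rewrite oc ?(ltnW jN) // /A sumrB mulrBr mulNr.
have approx m j : (0 < j < N)%N ->
    `|A (2 ^ m)%N j - pi / N%:R * cot (j%:R * pi / N%:R)| <= pi / N%:R * (2 / (2 ^ m)%:R).
  case/andP=> j0 jN; have j0R : 0 < j%:R :> R by rewrite ltr0n.
  have jNR : j%:R < N%:R :> R by rewrite ltr_nat.
  have w0 : 0 < pi / N%:R :> R by rewrite divr_gt0.
  have -> : A (2 ^ m)%N j = pi / N%:R * cot_partial (j%:R * pi / N%:R) (2 ^ m).
    rewrite /A /cot_partial big_distrr /=; apply: eq_bigr => q _.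
    rewrite !natrD natrM natrB ?(ltnW jN) //.
    have q0 : 0 <= q%:R * N%:R :> R by rewrite mulr_ge0.
    have n1 : j%:R + q%:R * N%:R != 0 :> R by rewrite gt_eqF // ltr_pwDl.
    have n2 : N%:R - j%:R + q%:R * N%:R != 0 :> R by rewrite gt_eqF // ltr_pwDl // subr_gt0.
    have -> : j%:R * pi / N%:R + q%:R * pi = (j%:R + q%:R * N%:R) * (pi / N%:R) :> R.
      by field; rewrite gt_eqF.
    have -> : pi - j%:R * pi / N%:R + q%:R * pi = (N%:R - j%:R + q%:R * N%:R) * (pi / N%:R) :> R.
      by field; rewrite gt_eqF.
    move: (_ + q%:R * _) (N%:R - _ + _) (pi / _) n1 n2 (gt_eqF w0) => P Q w n1 n2 /negbT w1.
    by field; rewrite n1 n2 w1.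
  rewrite -mulrBr normrM (gtr0_norm w0) distrC ler_pM2l //.
  apply: cot_partial_error_sym.
  by rewrite divr_gt0 ?mulr_gt0 //= ltr_pdivrMr // mulrC ltr_pM2l.
pose K := \sum_(1 <= j < N) `|c j| * (pi / N%:R).
have K0 : 0 <= K.
  by apply: sumr_ge0 => j _; apply: mulr_ge0 => //; rewrite divr_ge0 // ltW.
have small m : `|hsum c (2 ^ m * N)| <= K / (2 ^ m)%:R.
  have : `|2 * hsum c (2 ^ m * N)| <= K * (2 / (2 ^ m)%:R).
    have -> : 2 * hsum c (2 ^ m * N) =
       \sum_(1 <= j < N) c j * (A (2 ^ m)%N j - pi / N%:R * cot (j%:R * pi / N%:R)).
      under eq_bigr do rewrite mulrBr; rewrite sumrB -twice.
      under eq_bigr do rewrite mulrCA; rewrite -big_distrr /=.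
      by move: cc; rewrite (big_ltn N0) c0 mul0r add0r => ->; rewrite mulr0 subr0.
    apply: le_trans (ler_norm_sum _ _ _) _; rewrite /K big_distrl /=.
    apply: ler_sum_nat => j jN; rewrite normrM -[leRHS]mulrA; apply: ler_wpM2l => //.
    exact: approx.
  rewrite normrM (gtr0_norm (ltr0n R 2)) mulrCA ler_pM2l //.
apply: (vanishing_subseq N0 pc (odd_mod_sum oc c0)) => eps X eps0.
have [n Hn] := archi_nat (K / eps); pose m := (n + X)%N.
have mlt : (m < 2 ^ m)%N by rewrite ltn_expl.
exists (2 ^ m * N)%N.
  apply: leq_trans (leq_pmulr _ N0); apply: leq_trans (ltnW mlt); exact: leq_addl.
apply: le_trans (small m) _; rewrite ler_pdivrMr; last by rewrite ltr0n expn_gt0.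
rewrite mulrC -ler_pdivrMr //; apply: le_trans (ltW Hn) _; rewrite ler_nat.
by apply: leq_trans (ltnW mlt); exact: leq_addr.
Qed.

End CotangentVanishing.

(** * Cyclotomic conjugation *)

Section CyclotomicConjugation.
Variables (F : numFieldType) (N : nat).
Hypothesis N0 : (0 < N)%N.

Definition ratPhi : {poly rat} := map_poly intr 'Phi_N.
Local Notation toF := (map_poly (ratr : rat -> F)).

Lemma size_ratPhi : size ratPhi = (totient N).+1.
Proof. by rewrite size_map_inj_poly ?size_Cyclotomic //; exact: intr_inj. Qed.

(** Some factor ['Phi_d] of X^N - 1 vanishes at z; then z^d = 1, and primitivity forces d = N. *)
Lemma root_ratPhi (z : F) : N.-primitive_root z -> root (toF ratPhi) z.
Proof.
move=> zN; pose ev (p : {poly int}) := (map_poly (intr : int -> F) p).[z].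
have -> : root (toF ratPhi) z = (ev 'Phi_N == 0).
  rewrite /root /ratPhi -map_poly_comp; congr (_.[_] == 0).
  by apply: eq_map_poly => a /=; rewrite rmorph_int.
have evX n : ev ('X^n - 1) = z ^+ n - 1.
  by rewrite /ev rmorphB /= map_polyXn rmorph1 !hornerE.
have evP n : (0 < n)%N -> z ^+ n - 1 = \prod_(d <- divisors n) ev 'Phi_d.
  by move=> n0; rewrite -evX -(prod_Cyclotomic n0) /ev rmorph_prod horner_prod.
have := evP N N0; rewrite prim_expr_order // subrr => /esym/eqP.
rewrite prodf_seq_eq0 => /hasP[d]; rewrite -dvdn_divisors //= => dN ev0.
have d0 := dvdn_gt0 N0 dN; suff <- : d = N by [].
have /esym/eqP := evP d d0; rewrite (big_rem d) -?dvdn_divisors //= (eqP ev0) mul0r.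
rewrite eq_sym subr_eq0 => /eqP zd; apply/eqP; rewrite eqn_dvd dN /=.
by rewrite (prim_order_dvd zN) zd.
Qed.

Lemma ratPhi_dvdp (z : algC) (q : {poly rat}) : N.-primitive_root z ->
  root (map_poly ratr q) z = (ratPhi %| q).
Proof.
move=> zN; have [p [pE _] ->] := minCpolyP z; congr (_ %| _).
apply: (map_inj_poly (fmorph_inj (ratr : {rmorphism rat -> algC}))); first exact: rmorph0.
rewrite -pE (minCpoly_cyclotomic zN) -(Cintr_Cyclotomic zN) -map_poly_comp.
by apply: eq_map_poly => a /=; rewrite rmorph_int.
Qed.

(** Minimality of the cyclotomic polynomial is read off in algC while [z] lives in [F]; the rational
    gcd of [q] and [ratPhi] links them. If its cofactor had the root [w], [ratPhi] would divide that
    cofactor and the gcd would be constant, though it vanishes at [z]. So [w] is a root of the gcd,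
    which [ratPhi] then divides. *)
Lemma root_ratPhi_dvdp (z : F) (q : {poly rat}) : N.-primitive_root z ->
  root (toF q) z -> ratPhi %| q.
Proof.
move=> zN qz; have [w wN] := C_prim_root_exists N0.
have Phi0 : ratPhi != 0 by rewrite -size_poly_gt0 size_ratPhi.
pose g := gcdp q ratPhi.
have gz : root (toF g) z by rewrite gcdp_map root_gcd qz root_ratPhi.
have /dvdpP[h hE] : g %| ratPhi by exact: dvdp_gcdr.
have : root (map_poly ratr ratPhi) w by rewrite ratPhi_dvdp.
rewrite {1}hE rmorphM rootM !ratPhi_dvdp // => /orP[dh|dg]; last first.
  exact: dvdp_trans dg (dvdp_gcdl _ _).
have h0 : h != 0 by apply: contra_neq Phi0 => h0; rewrite hE h0 mul0r.
have g0 : g != 0 by apply: contra_neq Phi0 => g0; rewrite hE g0 mulr0.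
have := dvdp_leq h0 dh; rewrite {1}hE size_mul // => sz.
have g1 : (1 < size g)%N.
  by rewrite -(size_map_poly (ratr : {rmorphism rat -> F})) (root_size_gt1 _ gz) // map_poly_eq0.
have : (0 < size h)%N by rewrite size_poly_gt0.
by move: sz g1; move: (size g) (size h) => m n; lia.
Qed.

(** Galois conjugation in elementary form: a rational polynomial vanishing at z is a multiple of
    [ratPhi], which has z^a among its roots. *)
Lemma cyclotomic_conjugate (z : F) (q : {poly rat}) a :
  N.-primitive_root z -> coprime a N -> (toF q).[z] = 0 -> (toF q).[z ^+ a] = 0.
Proof.
move=> zN aN /rootP /(root_ratPhi_dvdp zN) /dvdpP[r ->].
rewrite rmorphM hornerM (rootP (root_ratPhi _)) ?mulr0 //.
by rewrite prim_root_exp_coprime.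
Qed.

Lemma horner_modp_ratPhi (z : F) (q : {poly rat}) : N.-primitive_root z ->
  (toF (q %% ratPhi)).[z] = (toF q).[z].
Proof.
move=> zN; rewrite [in RHS](divp_eq q ratPhi) rmorphD rmorphM hornerD hornerM.
by rewrite (rootP (root_ratPhi zN)) mulr0 add0r.
Qed.

End CyclotomicConjugation.

Lemma independent_span (K : fieldType) (J : finType) (d : nat) (v : J -> 'rV[K]_d) :
  #|J| = d ->
  (forall u : J -> K, \sum_j u j *: v j = 0 -> forall j, u j = 0) ->
  forall w, exists u : J -> K, w = \sum_j u j *: v j.
Proof.
move=> Jd indep w; pose M := \matrix_(i < #|J|) v (enum_val i).
have ME (u : 'rV_#|J|) : u *m M = \sum_j u 0 (enum_rank j) *: v j.
  rewrite mulmx_sum_row (reindex enum_rank) /=; last exact: onW_bij (enum_rank_bij J).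
  by apply: eq_bigr => j _; rewrite rowK enum_rankK.
have rf : row_free M.
  apply: inj_row_free => u; rewrite ME => /indep H; apply/rowP => k.
  by rewrite mxE -[k]enum_valK H.
have rfull : row_full M by move: rf; rewrite /row_free /row_full => /eqP->; rewrite Jd.
have /submxP[D ->] := submx_full w rfull.
by exists (fun j => D 0 (enum_rank j)); rewrite ME.
Qed.

(** * Cotangents as rational polynomials in a root of unity *)

Section RootOfUnity.
Variables (R : realType) (N : nat).
Hypothesis N0 : (0 < N)%N.

Definition zetaN : R[i] := (cos (2 * pi / N%:R) +i* sin (2 * pi / N%:R))%C.
Local Notation z := zetaN.

Lemma zetaN_exp k : z ^+ k = (cos (2 * (k%:R * pi / N%:R)) +i* sin (2 * (k%:R * pi / N%:R)))%C.
Proof.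
elim: k => [|k IH]; first by rewrite !mul0r mulr0 cos0 sin0.
rewrite exprS {}IH -(natr1 k) /zetaN.
have -> : 2 * ((k%:R + 1) * pi / N%:R) = 2 * pi / N%:R + 2 * (k%:R * pi / N%:R) :> R by ring.
rewrite cosD sinD; apply/eqP; rewrite eq_complex /=.
by apply/andP; split; apply/eqP; ring.
Qed.

Lemma zetaN_prim : N.-primitive_root z.
Proof.
have pi0 := pi_gt0 R; have N0R : 0 < N%:R :> R by rewrite ltr0n.
apply/andP; split=> //; apply/forallP => i; rewrite unity_rootE; apply/eqP.
case: (eqVneq i.+1 N) => [->|iN].
  apply/eqP; rewrite zetaN_exp; have -> : 2 * (N%:R * pi / N%:R) = pi *+ 2 :> R.
    by rewrite -mulr_natl; field; rewrite gt_eqF.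
  by rewrite cos2pi sin2pi.
apply/negbTE/negP => /eqP; rewrite zetaN_exp mulr_natl cos_mulr2n => -[].
rewrite cos2sin2 => E _; have lt : (i.+1 < N)%N by rewrite ltn_neqAle iN ltn_ord.
have s0 : 0 < sin (i.+1%:R * pi / N%:R) :> R.
  apply: sin_gt0_pi; rewrite divr_gt0 ?mulr_gt0 //= ltr_pdivrMr // mulrC ltr_pM2l //.
  by rewrite ltr_nat.
have := exprn_gt0 2 s0; lra.
Qed.

(* [sum_j j w^j = N / (w - 1)] for an [N]-th root of unity [w <> 1], so the polynomial
   below takes the value [(w + 1) / (w - 1) = - i cot(k pi / N)] at [w = zeta^k]. *)
Definition cot_poly k : {poly rat} :=
  1 + (2 / N%:R)%:P * \sum_(0 <= j < N) j%:R *: 'X^(k * j).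

Lemma root_unity_weighted_sum (F : fieldType) (w : F) n :
  (w - 1) * \sum_(0 <= j < n) j%:R * w ^+ j = n%:R * w ^+ n - \sum_(0 <= j < n) w ^+ j.+1.
Proof.
elim: n => [|n IH]; first by rewrite !big_geq // mulr0 mul0r subr0.
by rewrite !big_nat_recr //= mulrDr IH -natr1 exprS; ring.
Qed.

Lemma horner_cot_poly (F : numFieldType) (w : F) k : (w ^+ k) ^+ N = 1 -> w ^+ k != 1 ->
  (map_poly ratr (cot_poly k)).[w] = (w ^+ k + 1) / (w ^+ k - 1).
Proof.
set v := w ^+ k => vN v1; have v10 : v - 1 != 0 by rewrite subr_eq0.
have N0F : N%:R != 0 :> F by rewrite pnatr_eq0 -lt0n.
have sum0 : \sum_(0 <= j < N) v ^+ j.+1 = 0.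
  apply: (mulfI v10); rewrite mulr0.
  have -> : (v - 1) * \sum_(0 <= j < N) v ^+ j.+1 = v * (v ^+ N - 1).
    elim: (N) => [|n IH]; first by rewrite big_geq // !mulr0 expr0 subrr mulr0.
    by rewrite big_nat_recr //= mulrDr IH !exprS; ring.
  by rewrite vN subrr mulr0.
have S : (v - 1) * \sum_(0 <= j < N) j%:R * v ^+ j = N%:R.
  by rewrite root_unity_weighted_sum vN sum0 subr0 mulr1.
have -> : (map_poly ratr (cot_poly k)).[w] =
    1 + 2 / N%:R * \sum_(0 <= j < N) j%:R * v ^+ j.
  rewrite /cot_poly rmorphD rmorph1 rmorphM /= map_polyC rmorph_sum /= !hornerE horner_sum.
  rewrite fmorph_div !rmorph_nat; congr (1 + _ * _); apply: eq_bigr => j _.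
  by rewrite map_polyZ map_polyXn rmorph_nat !hornerE /v -exprM.
have -> : \sum_(0 <= j < N) j%:R * v ^+ j = N%:R / (v - 1).
  by rewrite -S mulrAC divff // mul1r.
by field; rewrite N0F v10.
Qed.

Lemma cot_polyE k a : ~~ (N %| a * k)%N ->
  (map_poly ratr (cot_poly k)).[z ^+ a] = (0 -i* cot ((a * k)%:R * pi / N%:R))%C.
Proof.
move=> ndiv.
have zak : (z ^+ a) ^+ k = z ^+ (a * k) by rewrite exprM.
rewrite horner_cot_poly zak; last 2 first.
- by rewrite -exprM mulnC exprM (prim_expr_order zetaN_prim) expr1n.
- by rewrite -(prim_order_dvd zetaN_prim).
have z1 : z ^+ (a * k) - 1 != 0 by rewrite subr_eq0 -(prim_order_dvd zetaN_prim).
apply: (mulIf z1); rewrite mulfVK //.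
move: z1; rewrite zetaN_exp; set x := _ * pi / _; rewrite mulr_natl cos_mulr2n sin_mulr2n.
rewrite /cot => z1; have s0 : sin x != 0.
  apply: contraNneq z1 => s0; rewrite cos2sin2 s0 expr0n mulr0 mul0rn subr0 eq_complex /=.
  by rewrite subr0 eqxx andbT; apply/eqP; ring.
apply/eqP; rewrite eq_complex /=; have E := cos2Dsin2 x.
move: (sin x) (cos x) s0 E => s c s0 E.
apply/andP; split; apply/eqP; first by field.
have -> : c ^+ 2 = 1 - s ^+ 2 by rewrite -E; ring.
by field.
Qed.

End RootOfUnity.

(** * Independence and span of the cotangents *)

Lemma coprime_subl N k : (k <= N)%N -> coprime (N - k) N = coprime k N.
Proof.
move=> kN; rewrite -{2 3}(subnK kN); move: (N - k)%N => m.
by rewrite /coprime gcdnDl gcdnDr gcdnC.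
Qed.

Section CotangentIndependence.
Variables (R : realType) (N : nat).
Hypothesis N3 : (3 <= N)%N.

Let N1 : (1 < N)%N. Proof. exact: ltnW. Qed.
Let N0 : (0 < N)%N. Proof. exact: ltnW. Qed.
Local Notation cotN k := (cot (k%:R * pi / N%:R) : R).
Local Notation toC := (map_poly (ratr : rat -> R[i])).

Lemma cotN_per : per N (fun k => cotN k).
Proof.
move=> k; rewrite natrD; have N0R : N%:R != 0 :> R by rewrite pnatr_eq0 -lt0n.
have -> : (k%:R + N%:R) * pi / N%:R = k%:R * pi / N%:R + pi :> R by field.
by rewrite /cot sinDpi cosDpi invrN mulrNN.
Qed.

Lemma prim_coprime k : prim_index N k -> coprime k N.
Proof. by case/and3P. Qed.

Lemma prim_subF k : (k <= N)%N -> prim_index N k -> prim_index N (N - k) = false.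
Proof. by move=> kN /and3P[_ k2 _]; apply/negP => /and3P[_ k2' _]; lia. Qed.

Section OddExtension.
Variable d : nat -> rat.

Definition odd_ext n : rat :=
  if prim_index N (n %% N) then d (n %% N)%N
  else if prim_index N (N - n %% N) then - d (N - n %% N)%N else 0.
Local Notation e := odd_ext.

Lemma odd_ext_modn n : e (n %% N)%N = e n.
Proof. by rewrite /e modn_mod. Qed.

Lemma odd_ext_supported n : ~~ coprime n N -> e n = 0.
Proof.
move=> nN; have rN : (n %% N <= N)%N by rewrite ltnW // ltn_pmod.
rewrite /e; case: ifP => [/prim_coprime|_]; first by rewrite coprime_modl (negbTE nN).
case: ifP => // /prim_coprime.
by rewrite coprime_subl // coprime_modl (negbTE nN).
Qed.

Lemma odd_extE k : (0 < k < N)%N ->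
  e k = (if prim_index N k then d k else 0) - (if prim_index N (N - k) then d (N - k)%N else 0).
Proof.
case/andP=> k0 kN; rewrite /e modn_small //.
case: ifP => [pk|_]; first by rewrite prim_subF ?(ltnW kN) // subr0.
by case: ifP; rewrite ?subr0 ?sub0r.
Qed.

Lemma odd_ext_odd k : (k <= N)%N -> e (N - k)%N = - e k.
Proof.
have e0 : e 0 = 0 by rewrite odd_ext_supported // /coprime gcd0n gtn_eqF.
have eN : e N = 0 by rewrite -odd_ext_modn modnn.
rewrite leq_eqVlt => /predU1P[->|kN]; first by rewrite subnn e0 eN oppr0.
case: (posnP k) => [->|k0]; first by rewrite subn0 e0 eN oppr0.
rewrite !odd_extE ?k0 //; last by rewrite subn_gt0 kN ltn_subrL k0.
by rewrite subKn ?(ltnW kN) // opprB.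
Qed.

Lemma odd_ext_neg m n : (N %| m + n)%N -> e m = - e n.
Proof.
move=> mn; have rN : (m %% N <= N)%N by rewrite ltnW // ltn_pmod.
have E : (n = N - m %% N %[mod N])%N.
  apply/eqP; rewrite -(eqn_modDl (m %% N)) subnKC // modnn modnDml.
  by rewrite -/(dvdn N (m + n)).
by rewrite -(odd_ext_modn n) E odd_ext_modn odd_ext_odd // odd_ext_modn opprK.
Qed.

(** Both factors change sign under k -> N - k, so each primitive index is counted twice. *)
Lemma odd_ext_sum : \sum_(0 <= k < N) ratr (e k) * cotN k =
  2 * \sum_(0 <= k < N | prim_index N k) ratr (d k) * cotN k.
Proof.
pose g k : R := if prim_index N k then ratr (d k) * cotN k else 0.
have -> : \sum_(0 <= k < N | prim_index N k) ratr (d k) * cotN k = \sum_(1 <= k < N) g k.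
  by rewrite big_mkcond (big_ltn N0) /= add0r.
rewrite (big_ltn N0) odd_ext_supported ?rmorph0 ?mul0r ?add0r; last first.
  by rewrite /coprime gcd0n gtn_eqF.
rewrite mulr_natl mulr2n -{2}(@sum_reflect R N) -big_split /=.
apply: eq_big_nat => k kN; rewrite odd_extE // /g rmorphB mulrBl; congr (_ + _).
  by case: ifP => _; rewrite ?rmorph0 ?mul0r.
have kN' : (k <= N)%N by case/andP: kN => _ /ltnW.
have -> : (N - k)%:R * pi / N%:R = pi - k%:R * pi / N%:R :> R.
  by rewrite natrB //; field; rewrite pnatr_eq0 -lt0n.
rewrite cot_pi_sub.
by case: ifP => _; rewrite ?rmorph0 ?mul0r ?oppr0 // mulrN.
Qed.

Lemma ratr_complex (q : rat) : ratr q = ((ratr q)%:C)%C :> R[i].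
Proof. by rewrite -(fmorph_eq_rat (real_complex R \o ratr)). Qed.

(** All twists of the relation are values at zeta^a of one rational polynomial, so
    [cyclotomic_conjugate] passes from a = 1 to every unit a. For k not prime to N the coefficient
    is 0; for the others N does not divide a k, as [cot_polyE] requires. *)
Lemma odd_ext_conjugate a : coprime a N ->
  (toC (\sum_(0 <= k < N) (e k)%:P * cot_poly N k)).[zetaN R N ^+ a] =
  (0 -i* \sum_(0 <= k < N) ratr (e k) * cotN (a * k)%N)%C.
Proof.
move=> aN; rewrite rmorph_sum horner_sum.
have imag_sum (f : nat -> R) n : (0 -i* \sum_(0 <= k < n) f k)%C =
    \sum_(0 <= k < n) (0 -i* f k)%C :> R[i].
  elim: n => [|n IH]; first by rewrite !big_geq // oppr0.
  rewrite !big_nat_recr //= -IH opprD; apply/eqP; rewrite eq_complex /=.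
  by apply/andP; split; apply/eqP; ring.
rewrite imag_sum.
apply: eq_bigr => k _; rewrite rmorphM /= map_polyC /= hornerM hornerC ratr_complex.
have [kN|kN] := boolP (coprime k N); last first.
  by rewrite odd_ext_supported // !rmorph0 !mul0r oppr0.
rewrite cot_polyE //.
  by apply/eqP; rewrite eq_complex /=; apply/andP; split; apply/eqP; ring.
have akN : coprime N (a * k) by rewrite coprime_sym coprimeMl aN.
apply/negP => Nak; move: akN; rewrite /coprime.
by move/gcdn_idPl: Nak => ->; rewrite gtn_eqF.
Qed.

Lemma odd_ext_vanishing :
  \sum_(0 <= k < N | prim_index N k) ratr (d k) * cotN k = 0 ->
  forall b, coprime b N -> vanishing (fun m => ratr (e (b * m)%N) : R).
Proof.
move=> rel b bN.
have pe : per N (fun k => ratr (e k) : R).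
  by move=> k; rewrite -(odd_ext_modn (k + N)) modnDr odd_ext_modn.
have galois a : coprime a N -> \sum_(0 <= k < N) ratr (e k) * cotN (a * k)%N = 0.
  move=> aN; set P := \sum_(0 <= k < N) (e k)%:P * cot_poly N k.
  have P1 : (toC P).[zetaN R N] = 0.
    rewrite -[zetaN R N]expr1 odd_ext_conjugate ?coprime1n //.
    by under eq_bigr do rewrite mul1n; rewrite odd_ext_sum rel mulr0 oppr0.
  have := cyclotomic_conjugate N0 (zetaN_prim R N0) aN P1.
  by rewrite odd_ext_conjugate // => -[] /eqP; rewrite oppr_eq0 => /eqP.
(* With [a] inverse to [b], substituting k -> b k turns the sum of e(k) cot(a k pi / N) into that of
   e(b k) cot(k pi / N), so conjugation by a gives the relation for the twist by b. *)
have [a aN ab] : exists2 a, coprime a N & (a * b = 1 %[mod N])%N.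
  have b0 : (0 < b)%N by case: (b) bN => //; rewrite /coprime gcd0n gtn_eqF.
  case: (egcdnP N b0) => a a' E _; rewrite (eqP bN) in E.
  have ab : (a * b = 1 %[mod N])%N by rewrite E modnMDl.
  exists a => //; have : coprime (a * b) N by rewrite -coprime_modl ab coprime_modl coprime1n.
  by rewrite coprimeMl => /andP[].
pose F k : R := ratr (e k) * cotN (a * k)%N.
have pF : per N F.
  move=> k; rewrite /F (pe k) mulnDr; congr (_ * _); apply: (per_eqmod cotN_per).
  by rewrite addnC modnMDl.
apply: (cot_vanishing N1).
- exact: (@per_mull R N (fun k => ratr (e k)) b pe).
- move=> k kN; rewrite -rmorphN; congr ratr; apply: odd_ext_neg.
  by rewrite -mulnDr subnK // dvdn_mull.
- by rewrite muln0 odd_ext_supported ?rmorph0 // /coprime gcd0n gtn_eqF.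
transitivity (\sum_(0 <= k < N) F (b * k)%N); last first.
  by rewrite (sum_mul_coprime N0 pF bN); exact: galois.
apply: eq_bigr => k _; rewrite /F; congr (_ * _); apply: (per_eqmod cotN_per).
by rewrite mulnA -modnMml ab modnMml mul1n.
Qed.

End OddExtension.

Lemma cot_independent (c : 'I_N -> rat) :
  \sum_(k : 'I_N | prim_index N k) ratr (c k) * cotN k = 0 ->
  forall k : 'I_N, prim_index N k -> c k = 0.
Proof.
move=> rel k pk; pose d n := oapp c 0 (insub n).
have dE (l : 'I_N) : d l = c l by rewrite /d valK.
have rel' : \sum_(0 <= k < N | prim_index N k) ratr (d k) * cotN k = 0.
  by rewrite big_mkord -[RHS]rel; apply: eq_bigr => l _; rewrite dE.
pose e n : R := ratr (odd_ext d n).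
have pe : per N e.
  by move=> n; rewrite /e -(odd_ext_modn d (n + N)) modnDr odd_ext_modn.
have se : supported N e by move=> n nN; rewrite /e odd_ext_supported ?rmorph0.
have oe : odd_mod N e by move=> n nN; rewrite /e odd_ext_odd // rmorphN.
have e0 : e 0%N = 0 by apply: se; rewrite /coprime gcd0n gtn_eqF.
have := nonvanishing N0 pe se (odd_mod_sum N1 oe e0) (odd_ext_vanishing rel') k.
rewrite /e /odd_ext modn_small // pk dE => /eqP.
by rewrite fmorph_eq0 => /eqP.
Qed.

(** The reflection k -> N - k matches the primitive indices with the units above N / 2. *)
Lemma card_prim : (#|[pred k : 'I_N | prim_index N k]|).*2 = totient N.
Proof.
pose g k := nat_of_bool (prim_index N k).
have -> : #|[pred k : 'I_N | prim_index N k]| = (\sum_(1 <= k < N) g k)%N.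
  transitivity (\sum_(0 <= k < N) g k)%N; last by rewrite (big_ltn N0).
  rewrite -sum1_card big_mkcond big_mkord; apply: eq_bigr => k _.
  by rewrite inE /g; case: prim_index.
rewrite totient_count_coprime (big_ltn N0).
have /negbTE-> : ~~ coprime N 0 by rewrite coprime_sym /coprime gcd0n gtn_eqF.
rewrite add0n -addnn {2}big_nat_rev -big_split /= /g.
apply: eq_big_nat => k /andP[k0 kN].
have -> : (1 + N - k.+1 = N - k)%N by lia.
have kN' := ltnW kN.
have [cop|ncop] := boolP (coprime N k); last first.
  have F l : coprime l N = coprime k N -> prim_index N l = false.
    by move=> E; apply/negP => /prim_coprime; rewrite E coprime_sym (negbTE ncop).
  by rewrite !F // coprime_subl.
(* A unit k = N / 2 would equal gcd(k, 2 k) = 1, giving N = 2. *)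
have k2 : k.*2 != N.
  apply: contraL cop => /eqP kE; rewrite -kE /coprime -mul2n gcdnC gcdnMl; move: N3 kE; lia.
rewrite coprime_sym in cop.
have E1 : prim_index N k = (k.*2 < N)%N by rewrite /prim_index k0 cop andbT.
have E2 : prim_index N (N - k) = ((N - k).*2 < N)%N.
  by rewrite /prim_index subn_gt0 kN coprime_subl // cop andbT.
by rewrite E1 E2; case: ltnP; case: ltnP => //; lia.
Qed.

Lemma cot_span j : (0 < j < N)%N -> exists c : 'I_N -> rat,
  cotN j = \sum_(k : 'I_N | prim_index N k) ratr (c k) * cotN k.
Proof.
move=> jN; pose A := [pred k : 'I_N | prim_index N k].
(* Index 1 witnesses that [A] is nonempty, as [enum_rank_in] requires. *)
have A1 : Ordinal N1 \in A by rewrite inE /= /prim_index /= coprime1n andbT.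
pose z := zetaN R N; have zP : N.-primitive_root z := zetaN_prim R N0.
have pi0 := pi_gt0 R; have N0R : 0 < N%:R :> R by rewrite ltr0n.
have cot1 : cotN 1 != 0.
  have H : 0 < (1 * pi / N%:R : R) < pi / 2.
    rewrite mul1r divr_gt0 //= ltr_pM2l // ltf_pV2 ?posrE //.
    by rewrite ltr_nat.
  rewrite mulf_neq0 // ?invr_neq0 // gt_eqF //; first by apply: cos_gt0_pihalf; lra.
  by apply: sin_gt0_pihalf.
have evc k : (0 < k < N)%N -> (toC (cot_poly N k)).[z] = (0 -i* cotN k)%C.
  case/andP=> k0 kN; rewrite -[z]expr1 cot_polyE ?mul1n //.
  by rewrite gtnNdvd.
(* The flag chooses between an imaginary value and its real multiple by - i cot(pi / N), so a
   relation splits into imaginary and real parts, each a rational relation among primitive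
   cotangents. *)
pose Q (x : bool * 'I_#|A|) : {poly rat} :=
  (if x.1 then 1 else cot_poly N 1) * cot_poly N (enum_val x.2).
(* Coordinates on Q(zeta_N): remainders modulo [ratPhi], of degree below phi(N). *)
pose v x : 'rV[rat]_(totient N) := poly_rV (Q x %% ratPhi N).
pose ev (w : 'rV[rat]_(totient N)) := (toC (rVpoly w)).[z].
have evrV p : ev (poly_rV (p %% ratPhi N)) = (toC p).[z].
  rewrite /ev poly_rV_K ?horner_modp_ratPhi // -ltnS -(size_ratPhi N) ltn_modp.
  by rewrite -size_poly_gt0 size_ratPhi.
have evsum (u : bool * 'I_#|A| -> rat) : ev (\sum_x u x *: v x) =
   ((- (cotN 1 * \sum_(i < #|A|) ratr (u (false, i)) * cotN (enum_val i)))
     -i* \sum_(i < #|A|) ratr (u (true, i)) * cotN (enum_val i))%C.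
  pose S b := \sum_(i < #|A|) ratr (u (b, i)) * cotN (enum_val i).
  have evZ w1 w2 q : ev (q *: w1 + w2) = ratr q * ev w1 + ev w2.
    by rewrite /ev linearP /= rmorphD /= map_polyZ hornerD hornerZ.
  have ev0 : ev 0 = 0 by rewrite /ev linear0 rmorph0 horner0.
  have -> : ev (\sum_x u x *: v x) = \sum_x ratr (u x) * ev (v x).
    apply: (big_ind2 (fun w y => ev w = y)) => //.
    - by move=> w1 y1 w2 y2 <- <-; rewrite -{1}[w1]scale1r evZ rmorph1 mul1r.
    - by move=> x _; rewrite -[u x *: _]addr0 evZ ev0 addr0.
  have evv b i : ev (v (b, i)) = if b then (0 -i* cotN (enum_val i))%C
      else ((- (cotN 1 * cotN (enum_val i)))%:C)%C.
    have k0 : (0 < enum_val i < N)%N.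
      by have := enum_valP i; rewrite inE => /andP[-> _]; rewrite ltn_ord.
    rewrite /v evrV /Q /= rmorphM hornerM /= (evc _ k0).
    case: b; first by rewrite rmorph1 hornerC mul1r.
    rewrite evc ?N1 //; apply/eqP; rewrite eq_complex /=.
    by apply/andP; split; apply/eqP; ring.
  have Sb b : \sum_i ratr (u (b, i)) * ev (v (b, i)) =
     if b then (0 -i* S b)%C else ((- (cotN 1 * S b))%:C)%C.
    rewrite /S; case: b.
      rewrite (eq_bigr (fun i => (0 -i* (ratr (u (true, i)) * cotN (enum_val i)))%C)).
        elim/big_rec2: _ => [|i y x _ ->]; first by rewrite oppr0.
        by apply/eqP; rewrite eq_complex /=; apply/andP; split; apply/eqP; ring.
      move=> i _; rewrite evv ratr_complex; apply/eqP; rewrite eq_complex /=.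
      by apply/andP; split; apply/eqP; ring.
    rewrite mulr_sumr -sumrN rmorph_sum; apply: eq_bigr => i _.
    rewrite evv ratr_complex -rmorphM /=; congr (_%:C)%C; ring.
  rewrite (eq_bigr (fun x => ratr (u (x.1, x.2)) * ev (v (x.1, x.2)))); last by case.
  rewrite -(pair_bigA _ (fun b i => ratr (u (b, i)) * ev (v (b, i)))) /= big_bool /= !Sb.
  apply/eqP; rewrite eq_complex /=; apply/andP; split; apply/eqP.
    by rewrite -/(S false); ring.
  by rewrite -/(S true); ring.
have toA (f : 'I_N -> R) : \sum_(i < #|A|) f (enum_val i) = \sum_(k : 'I_N | prim_index N k) f k.
  by rewrite -(big_enum_val (A := A) f).
have rankA (c : 'I_#|A| -> rat) :
    \sum_(i < #|A|) ratr (c i) * cotN (enum_val i) =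
    \sum_(k : 'I_N | prim_index N k) ratr (c (enum_rank_in A1 k)) * cotN k.
  by rewrite -toA; apply: eq_bigr => i _; rewrite enum_valK_in.
have indepA (c : 'I_#|A| -> rat) :
    \sum_(i < #|A|) ratr (c i) * cotN (enum_val i) = 0 -> forall i, c i = 0.
  rewrite rankA => /cot_independent H i; have := H (enum_val i) (enum_valP i).
  by rewrite enum_valK_in.
have [||u uE] := independent_span (v := v) _ _ (poly_rV (cot_poly N j %% ratPhi N)).
- by rewrite card_prod card_bool card_ord mul2n card_prim.
- move=> u u0; have := evsum u; rewrite u0.
  have -> : ev 0 = 0 by rewrite /ev linear0 rmorph0 horner0.
  case=> /esym/eqP; rewrite oppr_eq0 mulf_eq0 (negbTE cot1) /= => /eqP F0 /esym/eqP.
  rewrite oppr_eq0 => /eqP T0 [[] i]; first exact: (indepA (fun i => u (true, i)) T0).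
  exact: (indepA (fun i => u (false, i)) F0).
(* The value at the target is purely imaginary; comparing imaginary parts keeps only the
   coefficients with flag [true]. *)
exists (fun k => u (true, enum_rank_in A1 k)).
have := evsum u; rewrite -uE evrV evc // => -[_ /oppr_inj ->].
exact: (rankA (fun i => u (true, i))).
Qed.

End CotangentIndependence.

(** * From cotangents to scales *)

Lemma scaleE (R : realType) N k :
  scale R N k = tan (pi / N%:R) * cot (k%:R * pi / N%:R).
Proof. by rewrite /scale /cot {2}/tan invf_div. Qed.

Lemma sum_scale (R : realType) N (c : 'I_N -> rat) :
  \sum_(k : 'I_N | prim_index N k) ratr (c k) * scale R N k =
  tan (pi / N%:R) *
    \sum_(k : 'I_N | prim_index N k) ratr (c k) * cot (k%:R * pi / N%:R).
Proof. by rewrite mulr_sumr; apply: eq_bigr => k _; rewrite scaleE mulrCA. Qed.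

Theorem theorem2 (R : realType) (N : nat) (hN : (3 <= N)%N) :
  (* T is linearly independent over Q *)
  (forall c : 'I_N -> rat,
     \sum_(k : 'I_N | prim_index N k) ratr (c k) * scale R N k = 0 ->
     forall k : 'I_N, prim_index N k -> c k = 0)
  /\
  (* every t_j, 1 <= j < N/2, is a Q-linear combination of elements of T *)
  (forall j : nat, (0 < j)%N -> (j.*2 < N)%N ->
     exists c : 'I_N -> rat,
       scale R N j = \sum_(k : 'I_N | prim_index N k) ratr (c k) * scale R N k)
  /\
  (* |T| = phi(N)/2 *)
  #|[pred k : 'I_N | prim_index N k]| = (totient N)./2.
Proof.
split; [|split].
- move=> c; rewrite sum_scale => /eqP; rewrite mulf_eq0 => /orP[t0|/eqP]; last first.
    exact: cot_independent.
  have pi0 := pi_gt0 R; have N0R : 0 < N%:R :> R by rewrite ltr0n (ltn_trans _ hN).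
  have /andP[x0 xh] : 0 < (pi / N%:R : R) < pi / 2.
    by rewrite divr_gt0 //= ltr_pM2l // ltf_pV2 ?posrE // ltr_nat.
  suff : 0 < tan (pi / N%:R) :> R by rewrite (eqP t0) ltxx.
  rewrite divr_gt0 ?sin_gt0_pihalf ?x0 //.
  by apply: cos_gt0_pihalf; rewrite xh (lt_trans _ x0) // oppr_lt0 divr_gt0.
- move=> j j0 j2; have [|c cE] := cot_span R hN (j := j).
    by rewrite j0 (leq_ltn_trans _ j2) // -addnn leq_addr.
  by exists c; rewrite sum_scale scaleE cE.
- by rewrite -card_prim // doubleK.
Qed.
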